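(* Let $\boldsymbol{X}=(X_1,\ldots,X_d)\sim \mathcal{N}_d(\boldsymbol{0}_d,\Sigma)$ for some positive definite $d\times d$ matrix $\Sigma$, and let $\emptyset\neq\mathcal{J}\subsetneq\{1,\ldots,d\}$ be given, with complement $\mathcal{J}^{\complement}=\{1,\ldots,d\}\setminus\mathcal{J}$. Assume that $\nu_j\in[0,1/2)$ for all $j\in\mathcal{J}$. Then, for any convex function $\psi:\mathbb{R}^{d-|\mathcal{J}|}\to\mathbb{R}$ for which the two expectations involving $\psi$ below are finite, we have $$ \mathsf{E}\left[\prod_{j\in\mathcal{J}}|X_j|^{-2\nu_j}\times\psi\big((X_i)_{i\in\mathcal{J}^{\complement}}\big)\right]\leq\mathsf{E}\left[\prod_{j\in\mathcal{J}}|X_j|^{-2\nu_j}\right]\times\mathsf{E}\left[\psi\big((X_i)_{i\in\mathcal{J}^{\complement}}\big)\right]. $$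
   Context: $\mathcal{N}_d(\boldsymbol{0}_d,\Sigma)$ is the centered Gaussian law on $\mathbb{R}^d$ with covariance matrix $\Sigma$; positive definite matrices are symmetric. An expectation being finite means that the random variable inside it is integrable. *)

(* Defs.v *)
From HB Require Import structures.
From mathcomp Require Import all_boot all_order all_algebra.
From mathcomp Require Import all_classical all_reals all_analysis.

Set Implicit Arguments.
Unset Strict Implicit.
Unset Printing Implicit Defensive.

Import Order.TTheory GRing.Theory Num.Theory.
Import numFieldNormedType.Exports.

Local Open Scope classical_set_scope.
Local Open Scope ring_scope.

Definition posdefmx (R : realType) (n : nat) (S : 'M[R]_n) : Prop :=
  S^T = S /\ forall v : 'rV[R]_n, v != 0 -> 0 < (v *m S *m v^T) 0 0.

Definition tcons (T : Type) (n : nat) (p : T * n.-tuple T) : n.+1.-tuple T :=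
  [tuple of p.1 :: p.2].

Lemma tconsK (T : Type) (n : nat) (p : T * n.-tuple T) :
  (thead (tcons p), [tuple of behead (tcons p)]) = p.
Proof. by case: p => a b; rewrite theadE; congr pair; exact: val_inj. Qed.

(* Lebesgue measure on R^n, as the n-fold product of Lebesgue measure on R
   (a point mass for n = 0), on the product sigma-algebra of n.-tuple R. *)
Fixpoint lebesgue_tuple (R : realType) (n : nat) : set (n.-tuple R) -> \bar R :=
  match n with
  | 0 => \d_ [tuple]
  | m.+1 => pushforward
              (product_measure1 (@lebesgue_measure R) (@lebesgue_tuple R m))
              (@tcons R m)
  end.

Section lebesgue_tuple_measure.
Context (R : realType).
Local Open Scope ereal_scope.

Lemma measurable_tcons n :
  measurable_fun [set: R * n.-tuple R] (@tcons R n).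
Proof. exact: measurable_cons. Qed.

Lemma sigma_finite_pushforward_tcons n
    (m : {sigma_finite_measure set (n.-tuple R) -> \bar R}) :
  sigma_finite setT (pushforward (@lebesgue_measure R \x m) (@tcons R n)).
Proof.
have /sigma_finiteP[F [UF ndF mF]] := sigma_finiteT (@lebesgue_measure R).
have /sigma_finiteP[G [UG ndG mG]] := sigma_finiteT m.
pose uncons (x : n.+1.-tuple R) := (thead x, [tuple of behead x]).
exists (fun k => uncons @^-1` (F k `*` G k)).
  apply/seteqP; split => // x _.
  have [i _ Fi] : (\bigcup_i F i) (thead x) by rewrite -UF.
  have [j _ Gj] : (\bigcup_i G i) [tuple of behead x] by rewrite -UG.
  exists (maxn i j) => //=; split => /=.
  - by have /subsetPset := ndF _ _ (leq_maxl i j); exact.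
  - by have /subsetPset := ndG _ _ (leq_maxr i j); exact.
move=> k; have [mFk Fk] := mF k; have [mGk Gk] := mG k; split.
  rewrite -[X in measurable X]setTI.
  apply: (@measurable_fun_pair _ _ _ _ _ _ (fun x : n.+1.-tuple R => thead x)
     (fun x : n.+1.-tuple R => [tuple of behead x])) => //.
  - exact: measurable_tnth.
  - exact: measurable_behead.
  - exact: measurableX.
rewrite /pushforward (_ : _ @^-1` _ = F k `*` G k).
  by rewrite product_measure1E// lte_mul_pinfty// ge0_fin_numE.
rewrite -comp_preimage (_ : uncons \o _ = id) ?preimage_id//.
by apply/funext => p; exact: tconsK.
Qed.

Section successor.
Variables (n : nat) (m : {sigma_finite_measure set (n.-tuple R) -> \bar R}).

Let push := pushforward (@lebesgue_measure R \x m) (@tcons R n).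

Let push0 : push set0 = 0.
Proof. by rewrite /push /pushforward preimage_set0 measure0. Qed.

Let push_ge0 A : 0 <= push A. Proof. by rewrite /push /pushforward measure_ge0. Qed.

Let push_sigma_additive : semi_sigma_additive push.
Proof.
pose mf := measurable_tcons (n := n).
move=> F mF tF mUF; rewrite /push /pushforward preimage_bigcup.
apply: measure_semi_sigma_additive.
- by move=> k; rewrite -[X in measurable X]setTI; exact: mf.
- apply/trivIsetP => /= i j _ _ ij; rewrite -preimage_setI.
  by move/trivIsetP : tF => /(_ _ _ _ _ ij) ->//; rewrite preimage_set0.
- by rewrite -preimage_bigcup -[X in measurable X]setTI; exact: mf.
Qed.

HB.instance Definition _ := isMeasure.Build _ _ _ push
  push0 push_ge0 push_sigma_additive.

HB.instance Definition _ := @Measure_isSigmaFinite.Build _ _ _ push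
  (sigma_finite_pushforward_tcons m).

Lemma sigma_finite_measure_succ :
  exists m' : {sigma_finite_measure set (n.+1.-tuple R) -> \bar R},
    pushforward (@lebesgue_measure R \x m) (@tcons R n) = m'.
Proof. by exists push. Qed.

End successor.

Lemma lebesgue_tuple_sigma_finite_measure n :
  exists m : {sigma_finite_measure set (n.-tuple R) -> \bar R},
    @lebesgue_tuple R n = m.
Proof.
elim: n => [|n [m IH]]; first by exists (\d_ [tuple]).
by have [m' m'E] := sigma_finite_measure_succ m; exists m'; rewrite /= IH.
Qed.

Section instances.
Variable n : nat.

Let mu0 : @lebesgue_tuple R n set0 = 0.
Proof. by have [m ->] := lebesgue_tuple_sigma_finite_measure n. Qed.

Let mu_ge0 A : 0 <= @lebesgue_tuple R n A.
Proof. by have [m ->] := lebesgue_tuple_sigma_finite_measure n. Qed.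

Let mu_sigma_additive : semi_sigma_additive (@lebesgue_tuple R n).
Proof.
have [m ->] := lebesgue_tuple_sigma_finite_measure n.
exact: measure_semi_sigma_additive.
Qed.

HB.instance Definition _ := isMeasure.Build _ _ _ (@lebesgue_tuple R n)
  mu0 mu_ge0 mu_sigma_additive.

Let mu_sigma_finite : sigma_finite setT (@lebesgue_tuple R n).
Proof.
by have [m ->] := lebesgue_tuple_sigma_finite_measure n; exact: sigma_finiteT.
Qed.

HB.instance Definition _ := @Measure_isSigmaFinite.Build _ _ _
  (@lebesgue_tuple R n) mu_sigma_finite.

End instances.

Lemma measurable_tuple_box n (B : 'I_n -> set R) :
  (forall i, measurable (B i)) ->
  measurable [set x : n.-tuple R | forall i, B i (tnth x i)].
Proof.
move=> mB.
rewrite (_ : mkset _ = \bigcap_(i in [set: 'I_n]) (@tnth _ R ^~ i) @^-1` B i).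
  apply: fin_bigcap_measurable => // i _; rewrite -[X in measurable X]setTI.
  exact: measurable_tnth.
by apply/seteqP; split => x /= h i; [move=> _|]; exact: h.
Qed.

Lemma lebesgue_tuple_box n (B : 'I_n -> set R) :
  (forall i, measurable (B i)) ->
  lebesgue_tuple [set x : n.-tuple R | forall i, B i (tnth x i)]
  = \prod_(i < n) lebesgue_measure (B i).
Proof.
move=> mB.
elim: n B mB => [|n IH] B mB.
  rewrite big_ord0 /= (_ : mkset _ = setT) ?diracT//.
  by apply/seteqP; split => // x _ [].
rewrite big_ord_recl -(IH (fun i => B (lift ord0 i)))//= /pushforward.
rewrite (_ : _ @^-1` _ = B ord0 `*`
    [set x | forall i : 'I_n, B (lift ord0 i) (tnth x i)]).
  have [m mE] := lebesgue_tuple_sigma_finite_measure n.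
  rewrite mE product_measure1E//; first exact: (mB ord0).
  exact: (measurable_tuple_box (fun i => mB (lift ord0 i))).
apply/seteqP; split => -[a b] /=.
- move=> h; split; first exact: (h ord0).
  by move=> i; have := h (lift ord0 i); rewrite tnthS.
- move=> [Ba h] i; case: (unliftP ord0 i) => [j|] ->//.
  by rewrite tnthS.
Qed.
End lebesgue_tuple_measure.

Definition multinormal_pdf (R : realType) (n : nat) (S : 'M[R]_n)
    (x : n.-tuple R) : R :=
  let v := \row_i tnth x i in
  (Num.sqrt ((2 * pi) ^+ n * \det S))^-1
  * expR (- 2^-1 * (v *m invmx S *m v^T) 0 0).

(* The centered Gaussian law N(0, S), for S positive definite; as with
   normal_prob, only the values at measurable sets are meaningful. *)
Definition multinormal_prob (R : realType) (n : nat) (S : 'M[R]_n) :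
    set (n.-tuple R) -> \bar R :=
  fun A => (\int[@lebesgue_tuple R n]_(x in A) (multinormal_pdf S x)%:E)%E.

(* Main.v *)
(* Replacing psi by its even part minus psi(0) subtracts psi(0) E[W] from both
   sides, where W is the product of the |X_j|^(-2 nu_j); so one may assume psi
   convex and nonnegative, and only Tonelli's theorem is needed. Each factor |x_j|^(-2 nu_j) is a
   mixture over s > 0 of the Gaussian tilts exp(- s x_j^2 / 2), and tilting
   N(0, K^-1) by such a factor gives N(0, (K + s e_j e_j^T)^-1). The
   Sherman-Morrison formula makes the difference of the two covariance matrices
   a positive matrix of rank one, so that N(0, K^-1) is the law of Y + g u with Y
   distributed according to the tilted law, u a fixed vector and g an independent
   centered scalar Gaussian variable; by convexity the expectation of psi
   decreases under the tilt. The factors are treated one after the other,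
   for all K at once. *)

(* The inequality is kept in the homogeneous form [E[w f] E[1] <= E[w] E[f]] for unnormalized
   Gaussian integrals of precision [K]. A tilt changes the total mass, which here costs one scalar
   ratio [r], common to [f] and to the constant 1; no determinant is computed, and the normalizing
   constant of the law is read off from total mass one. [K] cannot stay fixed: once one power has
   been mixed out, the remaining ones are integrated against the tilted weight. Writing [E'] for the
   tilted integral, the induction hypothesis bounds [E'[w f] E'[1]] by [E'[w] E'[f]], and [E'[1] = r
   E[1]], [E'[f] <= r E[f]] lead back to [K]. This takes place in the nonnegative extended reals,
   where infinite integrals do no harm. Finiteness matters for subtracting [psi(0) E[W]], and there
   the bound [nu_j < 1/2] enters. Symmetrizing changes neither side because the law and the weight
   are even. *)
From HB Require Import structures.
Require Import Defs.
From mathcomp Require Import all_boot all_order all_algebra.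
From mathcomp Require Import all_classical all_reals all_analysis.
From mathcomp Require Import measurable_realfun ring lra.
Import Order.TTheory GRing.Theory Num.Theory.
Import numFieldNormedType.Exports.
Local Open Scope classical_set_scope.
Local Open Scope ring_scope.

Set Implicit Arguments.
Unset Strict Implicit.
Unset Printing Implicit Defensive.

(* [sigma_finite_measure_succ] in Defs registers canonical structures on
   [pushforward] that hide the generic one of the library. *)
Local Notation pushforward_measure :=
  measure_function_pushforward__canonical__measure_function_Measure.

(** * Integrals under measure-preserving maps *)

Section measure_preserving.
Local Open Scope ereal_scope.
Context d (T : measurableType d) (R : realType) (mu : {measure set T -> \bar R}).
Variable s : T -> T.

(* [nu] is the image of [mu] by [s]: it equips [fun A => mu (s @^-1` A)] with the
   measure structure that uniqueness theorems require. *)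
Lemma ge0_integral_preserving (F : T -> \bar R) :
  measurable_fun [set: T] s ->
  (forall nu : {measure set T -> \bar R},
     (forall A, nu A = mu (s @^-1` A)) ->
     forall A, measurable A -> mu (s @^-1` A) = mu A) ->
  measurable_fun [set: T] F -> (forall x, 0 <= F x) ->
  \int[mu]_x F (s x) = \int[mu]_x F x.
Proof.
move=> ms inv mF F0.
pose nu := pushforward_measure mu ms.
transitivity (\int[nu]_x F x).
  by rewrite [RHS](ge0_integral_pushforward ms).
apply: (eq_measure_integral mu) => A mA _.
exact: (inv nu).
Qed.

End measure_preserving.

(** * Tonelli on tuples and invariance of Lebesgue measure *)

Section integral_tools.
Local Open Scope ereal_scope.
Context (R : realType).
Notation leb := (@lebesgue_measure R).

Lemma integral_lebesgue_shift (F : R -> \bar R) (b : R) :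
  measurable_fun [set: R] F -> (forall x, 0 <= F x) ->
  \int[leb]_x F (x + b)%R = \int[leb]_x F x.
Proof.
move=> mF F0; pose s (x : measurableTypeR R) : measurableTypeR R := (x + b)%R.
apply: (@ge0_integral_preserving _ (measurableTypeR R) R leb s) => //.
  exact: measurable_funD.
move=> mu muE A mA; rewrite -muE; apply/esym.
apply: lebesgue_measure_unique => //= _ [[a c]] _ <-.
rewrite muE (_ : s @^-1` _ = `](a - b)%R, (c - b)%R]%classic); last first.
  by apply/seteqP; split => x /=; rewrite !in_itv/= ltrBlDr lerBrDr.
rewrite [LHS]lebesgue_measure_itv [RHS]lebesgue_measure_itv /=.
rewrite !lte_fin ltrD2r -!EFinB.
by case: ifP => // _; congr EFin; ring.
Qed.

Lemma integral_lebesgue_opp (F : R -> \bar R) :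
  measurable_fun [set: R] F -> (forall x, 0 <= F x) ->
  \int[leb]_x F (- x)%R = \int[leb]_x F x.
Proof.
move=> mF F0.
apply: (@ge0_integral_preserving _ (measurableTypeR R) R leb
  (-%R : measurableTypeR R -> measurableTypeR R)) => //.
by move=> mu _ A mA; exact: lebesgue_measureN.
Qed.

Lemma measurable_coord n (i : 'I_n) :
  measurable_fun [set: n.-tuple R] (fun x => tnth x i).
Proof. exact: measurable_tnth. Qed.

Lemma measurable_tcons_section n (a : R) :
  measurable_fun [set: n.-tuple R] (fun b => tcons (a, b)).
Proof.
exact: (@measurable_cons _ _ (n.-tuple R) R (cst a) n id).
Qed.

Lemma integral_lebesgue_tuple0 (F : 0.-tuple R -> \bar R) :
  \int[@lebesgue_tuple R 0]_x F x = F [tuple].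
Proof.
rewrite [LHS]integral_dirac//= ?diracT ?mul1e//.
rewrite (_ : F = cst (F [tuple]))//.
by apply/funext => x; rewrite [x]tuple0.
Qed.

Lemma integral_lebesgue_tupleS n (F : n.+1.-tuple R -> \bar R) :
  measurable_fun [set: n.+1.-tuple R] F -> (forall x, 0 <= F x) ->
  \int[@lebesgue_tuple R n.+1]_x F x =
  \int[leb]_a \int[@lebesgue_tuple R n]_b F (tcons (a, b)).
Proof.
move=> mF F0.
have mt := @measurable_tcons R n.
transitivity (\int[pushforward_measure (leb \x @lebesgue_tuple R n) mt]_x F x).
  exact: eq_measure_integral.
rewrite ge0_integral_pushforward//= preimage_setT fubini_tonelli1//.
exact: measurableT_comp.
Qed.

(** Translation and reflection both act coordinate by coordinate, so invariance on tuples reduces by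
    Tonelli to invariance on the line. *)
Lemma lebesgue_tuple_invariant n (s : 'I_n -> R -> R)
    (F : n.-tuple R -> \bar R) :
  (forall i, measurable_fun [set: R] (s i)) ->
  (forall i (G : R -> \bar R), measurable_fun [set: R] G -> (forall x, 0 <= G x) ->
    \int[leb]_x G (s i x) = \int[leb]_x G x) ->
  measurable_fun [set: n.-tuple R] F -> (forall x, 0 <= F x) ->
  \int[@lebesgue_tuple R n]_x F [tuple s i (tnth x i) | i < n] =
  \int[@lebesgue_tuple R n]_x F x.
Proof.
elim: n s F => [|n IH] s F ms inv mF F0.
  by rewrite !integral_lebesgue_tuple0 [[tuple _ | _ < _]]tuple0.
have mt := @measurable_tcons R n.
have mFt : measurable_fun setT (F \o @tcons R n) by exact: measurableT_comp.
have mFs : measurable_fun [set: n.+1.-tuple R]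
    (fun x => F [tuple s i (tnth x i) | i < n.+1]).
  apply: measurableT_comp => //; apply/measurable_fun_tnthP => i.
  rewrite (_ : _ \o _ = s i \o (fun x : n.+1.-tuple R => tnth x i)).
    by apply: measurableT_comp; [exact: ms|exact: measurable_coord].
  by apply/funext => x /=; rewrite tnth_mktuple.
rewrite (integral_lebesgue_tupleS mFs (fun x => F0 _)).
rewrite (integral_lebesgue_tupleS mF F0).
pose G a := \int[@lebesgue_tuple R n]_b F (tcons (a, b)).
rewrite -[RHS]/(\int[leb]_a G a) -(inv ord0 G); last 2 first.
- apply: (measurable_fun_fubini_tonelli_F (m2 := @lebesgue_tuple R n) _ mFt).
  by move=> x; exact: F0.
- by move=> a; exact: integral_ge0.
apply: eq_integral => a _; rewrite /G.
rewrite -[RHS](IH (fun i => s (lift ord0 i)))//; last 2 first.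
  by move=> i; exact: inv.
  exact: (measurableT_comp mF (measurable_tcons_section _)).
apply: eq_integral => b _; congr F; apply: eq_from_tnth => i.
rewrite tnth_mktuple; case: (unliftP ord0 i) => [j|] ->.
  by rewrite !tnthS tnth_mktuple.
by rewrite !tnth0.
Qed.

Lemma lebesgue_tuple_shift n (u : 'I_n -> R) (F : n.-tuple R -> \bar R) :
  measurable_fun [set: n.-tuple R] F -> (forall x, 0 <= F x) ->
  \int[@lebesgue_tuple R n]_x F [tuple (tnth x i + u i)%R | i < n] =
  \int[@lebesgue_tuple R n]_x F x.
Proof.
move=> mF F0; apply: (@lebesgue_tuple_invariant n (fun i x => x + u i)%R) => //.
- by move=> i; exact: measurable_funD.
- by move=> i G mG G0; exact: integral_lebesgue_shift.
Qed.

Lemma lebesgue_tuple_opp n (F : n.-tuple R -> \bar R) :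
  measurable_fun [set: n.-tuple R] F -> (forall x, 0 <= F x) ->
  \int[@lebesgue_tuple R n]_x F [tuple (- tnth x i)%R | i < n] =
  \int[@lebesgue_tuple R n]_x F x.
Proof.
move=> mF F0; apply: (@lebesgue_tuple_invariant n (fun i x => - x)%R) => //.
- by move=> i; exact: measurableT_comp.
- by move=> i G mG G0; exact: integral_lebesgue_opp.
Qed.

Lemma integral_lebesgue_tuple_prod n (h : 'I_n -> R -> \bar R) :
  (forall i, measurable_fun [set: R] (h i)) -> (forall i x, 0 <= h i x) ->
  \int[@lebesgue_tuple R n]_x \prod_(i < n) h i (tnth x i) =
  \prod_(i < n) \int[leb]_x h i x.
Proof.
have mp m (k : 'I_m -> R -> \bar R) : (forall i, measurable_fun [set: R] (k i)) ->
    measurable_fun [set: m.-tuple R] (fun x => \prod_(i < m) k i (tnth x i)).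
  move=> mk; elim: (index_enum _) => [|i r IH].
    by under eq_fun do rewrite big_nil; exact: measurable_cst.
  under eq_fun do rewrite big_cons; apply: emeasurable_funM => //.
  by apply: measurableT_comp; [exact: mk|exact: measurable_coord].
elim: n h => [|n IH] h mh h0.
  by rewrite integral_lebesgue_tuple0 !big_ord0.
rewrite integral_lebesgue_tupleS//; last 2 first.
  exact: mp.
  by move=> x; apply: prode_ge0.
rewrite big_ord_recl -IH//.
rewrite -ge0_integralZr//; last by apply: integral_ge0 => x _; exact: prode_ge0.
apply: eq_integral => a _.
rewrite -ge0_integralZl//; last 2 first.
  exact: (mp _ (fun i => h (lift ord0 i)) (fun i => mh _)).
  by move=> x _; exact: prode_ge0.
apply: eq_integral => b _; rewrite big_ord_recl tnth0; congr (_ * _).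
by apply: eq_bigr => i _; rewrite tnthS.
exact: (mh ord0).
Qed.

(** On this hyperplane the mixture formula for [|x_j|^(-2 nu_j)] with [nu_j > 0] breaks down, the
    power at 0 having the default value 0. *)
Lemma lebesgue_tuple_hyperplane n (j : 'I_n) :
  @lebesgue_tuple R n [set x | tnth x j = 0%R] = 0.
Proof.
pose B (i : 'I_n) := if i == j then [set 0%R] else [set: R].
rewrite (_ : mkset _ = [set x | forall i, B i (tnth x i)]).
  rewrite lebesgue_tuple_box; last by move=> i; rewrite /B; case: ifP.
  by rewrite (bigD1 j)//= /B eqxx lebesgue_measure_set1 mul0e.
apply/seteqP; split => x /=.
  by move=> xj i; rewrite /B; case: eqP => // ->.
by move=> /(_ j); rewrite /B eqxx.
Qed.

End integral_tools.

(** * Measurability of convex functions *)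

Section convex_measurability.
Context (R : realType).

(** The chord from [a] to [a + e] lies above [g], so close to [a] on that side [g] stays below [c].
    [M] bounds the slope of the chord, with 1 added so that it can be divided by. *)
Lemma convex_lt_near (g : R -> R) (a e c : R) :
  (forall t x y, 0 <= t <= 1 ->
     g (t * x + (1 - t) * y) <= t * g x + (1 - t) * g y) ->
  g a < c -> exists2 r : R, 0 < r & forall s, 0 < s < r -> g (a + s * e) < c.
Proof.
move=> cg gac; pose M := `|g (a + e) - g a| + 1.
have M0 : 0 < M by rewrite /M ltr_wpDl.
exists (Num.min 1 ((c - g a) / M)); first by rewrite lt_min ltr01 divr_gt0// subr_gt0.
move=> s /andP[s0]; rewrite lt_min => /andP[s1 sM].
have := cg s (a + e) a; rewrite (ltW s0) (ltW s1) => /(_ isT).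
rewrite (_ : s * (a + e) + (1 - s) * a = a + s * e); last by ring.
move=> /le_lt_trans; apply.
rewrite (_ : s * g (a + e) + (1 - s) * g a = g a + s * (g (a + e) - g a));
  last by ring.
rewrite -ltrBrDl; apply: (@le_lt_trans _ _ (s * M)).
  by rewrite ler_pM2l// (le_trans (ler_norm _))// lerDl.
by rewrite -ltr_pdivlMr.
Qed.

Definition tuple_convex n (f : n.-tuple R -> R) := forall t x y, 0 <= t <= 1 ->
  f [tuple t * tnth x i + (1 - t) * tnth y i | i < n] <= t * f x + (1 - t) * f y.

Let tcons_comb n t (a b : R) (x y : n.-tuple R) :
  [tuple t * tnth (tcons (a, x)) i + (1 - t) * tnth (tcons (b, y)) i | i < n.+1]
  = tcons (t * a + (1 - t) * b,
           [tuple t * tnth x i + (1 - t) * tnth y i | i < n]).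
Proof.
apply: eq_from_tnth => i; rewrite tnth_mktuple.
by case: (unliftP ord0 i) => [j|] ->; rewrite ?tnthS ?tnth_mktuple// !tnth0.
Qed.

(** A point satisfies [f < c] iff its head lies between two rationals [p], [q] at which [f], with
    the same tail, is below [c]. Convexity between [p] and [q] gives one direction, [convex_lt_near]
    on both sides of the head the other. The slices at [p] and [q] are convex in one variable less,
    hence measurable by induction, and the union is countable. *)
Lemma measurable_tuple_convex n (f : n.-tuple R -> R) :
  tuple_convex f -> measurable_fun [set: n.-tuple R] f.
Proof.
elim: n f => [|n IH] f cf.
  rewrite (_ : f = cst (f [tuple])); first exact: measurable_cst.
  by apply/funext => x; rewrite [x]tuple0.
have cf1 p : tuple_convex (fun b => f (tcons (p, b))).
  move=> t x y t01; have := cf t (tcons (p, x)) (tcons (p, y)) t01.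
  by rewrite tcons_comb (_ : t * p + (1 - t) * p = p)//; ring.
have cf2 b t x y : 0 <= t <= 1 -> f (tcons (t * x + (1 - t) * y, b)) <=
    t * f (tcons (x, b)) + (1 - t) * f (tcons (y, b)).
  move=> t01; have := cf t (tcons (x, b)) (tcons (y, b)) t01.
  rewrite tcons_comb (_ : [tuple _ | _ < _] = b)//.
  by apply: eq_from_tnth => i; rewrite tnth_mktuple; ring.
pose bh (x : n.+1.-tuple R) : n.-tuple R := [tuple of behead x].
have mbh : measurable_fun [set: n.+1.-tuple R] bh by exact: measurable_behead.
have xE (x : n.+1.-tuple R) : x = tcons (tnth x ord0, bh x).
  exact: tuple_eta.
have mg p : measurable_fun [set: n.+1.-tuple R] (fun x => f (tcons (p, bh x))).
  by apply: (measurableT_comp (IH _ (cf1 p)) mbh).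
apply: (measurability _ (RGenInftyO.measurableE R)) => /= _ [_ [c ->] <-].
rewrite setTI.
pose U (pq : rat * rat) := [set x : n.+1.-tuple R | ratr pq.1 < tnth x ord0 < ratr pq.2]
  `&` [set x | f (tcons (ratr pq.1, bh x)) < c]
  `&` [set x | f (tcons (ratr pq.2, bh x)) < c].
rewrite (_ : _ @^-1` _ = \bigcup_pq U pq).
  apply: countable_bigcupT_measurable => // -[p q].
  have m1 (h : n.+1.-tuple R -> R) (I : interval R) :
      measurable_fun [set: n.+1.-tuple R] h -> measurable [set x | h x \in I].
    move=> mh; have := mh measurableT _ (measurable_itv I); rewrite setTI//.
  apply: measurableI; first apply: measurableI.
  - rewrite (_ : mkset _ = [set x | tnth x ord0 \in `]ratr p, ratr q[]).
      by apply: m1; exact: measurable_tnth.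
    by apply/seteqP; split => x; rewrite /= in_itv.
  - rewrite (_ : mkset _ = [set x | f (tcons (ratr p, bh x)) \in `]-oo, c[]).
      exact: m1.
    by apply/seteqP; split => x; rewrite /= in_itv.
  - rewrite (_ : mkset _ = [set x | f (tcons (ratr q, bh x)) \in `]-oo, c[]).
      exact: m1.
    by apply/seteqP; split => x; rewrite /= in_itv.
apply/seteqP; split => x; rewrite /= in_itv/=; last first.
  move=> [[p q] _ [[/= /andP[pa aq] fp] fq]].
  rewrite [x]xE; set a := tnth x ord0 in pa aq *.
  pose t := (ratr q - a) / (ratr q - ratr p).
  have pq : 0 < ratr q - ratr p :> R by rewrite subr_gt0 (lt_trans pa).
  have t01 : 0 <= t <= 1.
    rewrite /t ler_pdivrMr// mul1r lerD2l lerN2 (ltW pa) andbT.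
    by rewrite divr_ge0 ?(ltW pq)// subr_ge0 ltW.
  have := cf2 (bh x) t (ratr p) (ratr q) t01.
  rewrite (_ : t * ratr p + (1 - t) * ratr q = a); last first.
    by rewrite /t; field; rewrite gt_eqF.
  move=> /le_lt_trans; apply.
  have /andP[t0 t1] := t01.
  have [t00|tn0] := eqVneq t 0; first by rewrite t00 mul0r add0r subr0 mul1r.
  rewrite (_ : c = t * c + (1 - t) * c); last by ring.
  apply: ltr_leD; first by rewrite ltr_pM2l// lt_def tn0.
  by rewrite ler_wpM2l ?subr_ge0// ltW.
rewrite {1}[x]xE; set a := tnth x ord0 => fc.
have [r1 r10 Hr1] := convex_lt_near (- 1) (cf2 (bh x)) fc.
have [r2 r20 Hr2] := convex_lt_near 1 (cf2 (bh x)) fc.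
have [p] : exists q, ratr q \in `]a - r1, a[.
  by apply: rat_in_itvoo; rewrite ltrBlDr ltrDl.
have [q] : exists q, ratr q \in `]a, a + r2[.
  by apply: rat_in_itvoo; rewrite ltrDl.
rewrite !in_itv/= => /andP[aq qa] /andP[ap pa].
exists (p, q) => //; split; [split|] => /=; first by rewrite pa aq.
  have := Hr1 (a - ratr p); rewrite (_ : a + (a - ratr p) * -1 = ratr p); last by ring.
  by apply; rewrite subr_gt0 pa/= ltrBlDr addrC -ltrBlDr.
have := Hr2 (ratr q - a); rewrite (_ : a + (ratr q - a) * 1 = ratr q); last by ring.
by apply; rewrite subr_gt0 aq/= ltrBlDr addrC.
Qed.

End convex_measurability.

(** * Quadratic forms of positive definite matrices *)

Section quadratic_form.
Context (R : realType) (n : nat).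
Implicit Types (K : 'M[R]_n) (v : 'rV[R]_n) (j : 'I_n).

Definition qform K v : R := (v *m K *m v^T) 0 0.

Lemma qform_delta j v : qform (delta_mx j j) v = v 0 j ^+ 2.
Proof.
rewrite /qform -(mul_delta_mx (0 : 'I_1)) mulmxA -mulmxA -colE -rowE.
by rewrite mxE big_ord1 !mxE.
Qed.

Lemma qformD K s j v : qform (K + s *: delta_mx j j) v = qform K v + s * v 0 j ^+ 2.
Proof.
rewrite -qform_delta /qform mulmxDr mulmxDl mxE; congr (_ + _).
by rewrite -scalemxAr -scalemxAl mxE.
Qed.

Lemma posdefmx_unit K : posdefmx K -> K \in unitmx.
Proof.
move=> [_ K0]; rewrite -row_free_unit; apply: inj_row_free => v vK.
apply/eqP; apply/negPn/negP => /K0; rewrite vK mul0mx mxE ltxx//.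
Qed.

Lemma posdefmx_inv K : posdefmx K -> posdefmx (invmx K).
Proof.
move=> pK; have uK := posdefmx_unit pK; have [sK K0] := pK.
split; first by rewrite trmx_inv sK.
move=> v v0; pose w := v *m invmx K.
have vE : v = w *m K by rewrite mulmxKV.
have w0 : w != 0 by apply: contraNneq v0 => w0; rewrite vE w0 mul0mx.
by rewrite -/w vE trmx_mul sK mulmxA; exact: K0.
Qed.

Lemma posdefmxD K s j : 0 <= s -> posdefmx K -> posdefmx (K + s *: delta_mx j j).
Proof.
move=> s0 [sK K0]; split; first by rewrite linearD linearZ/= trmx_delta sK.
move=> v /K0 v0; rewrite -/(qform _ v) qformD.
by rewrite ltr_wpDr// mulr_ge0// sqr_ge0.
Qed.

(** The row [u] of the inverse solves [u K = e_j], so both cross terms are the coordinate [v_j], and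
    [u K u^T] is the diagonal entry. *)
Lemma qform_shift K j v a : posdefmx K ->
  qform K (v + a *: row j (invmx K)) =
  qform K v + a * v 0 j *+ 2 + a ^+ 2 * invmx K j j.
Proof.
move=> pK; have uK := posdefmx_unit pK; have [sK K0] := pK.
set u := row j _.
pose e : 'rV[R]_n := delta_mx 0 j.
have uE : u = e *m invmx K by rewrite -rowE.
have uKE : u *m K = e by rewrite uE mulmxKV.
have KuE : K *m u^T = e^T by rewrite -uKE trmx_mul sK.
have dE (w : 'rV[R]_n) : (e *m w^T) 0 0 = w 0 j by rewrite -rowE !mxE.
have Ed (w : 'rV[R]_n) : (w *m e^T) 0 0 = w 0 j.
  by rewrite trmx_delta -colE mxE.
have tE : (v + a *: u)^T = v^T + a *: u^T by rewrite linearD linearZ.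
rewrite /qform tE !mulmxDl !mulmxDr.
rewrite -!scalemxAl -!scalemxAr uKE -!mulmxA KuE.
have DE (A B : 'M[R]_1) : (A + B) 0 0 = A 0 0 + B 0 0 by rewrite mxE.
have ZE (A : 'M[R]_1) : (a *: A) 0 0 = a * A 0 0 by rewrite mxE.
by rewrite !DE !ZE !dE Ed [u 0 j]mxE; ring.
Qed.

Lemma invmx_diag_gt0 K j : posdefmx K -> 0 < invmx K j j.
Proof.
move=> /posdefmx_inv[_ /(_ (delta_mx 0 j))].
rewrite -rowE (_ : (row j _ *m _) 0 0 = invmx K j j).
  apply; apply/eqP => /matrixP/(_ 0 j); rewrite !mxE !eqxx => /eqP.
  by rewrite oner_eq0.
by rewrite trmx_delta -colE !mxE.
Qed.

(** Cauchy-Schwarz for the form [K]: the nonnegative function [a -> qform K (v + a u)] is evaluated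
    at its minimum [a = - v_j / b]. *)
Lemma qform_coord_le K j v : posdefmx K -> v 0 j ^+ 2 <= invmx K j j * qform K v.
Proof.
move=> pK; have b0 := invmx_diag_gt0 j pK; set b := invmx K j j in b0 *.
have : 0 <= qform K (v + (- (v 0 j / b)) *: row j (invmx K)).
  have [->|v0] := eqVneq (v + (- (v 0 j / b)) *: row j (invmx K)) 0.
    by rewrite /qform !mul0mx mxE.
  by apply/ltW; apply: (pK.2).
rewrite qform_shift// -/b.
rewrite (_ : _ + _ + _ = qform K v - v 0 j ^+ 2 / b); last by field; rewrite gt_eqF.
by rewrite subr_ge0 ler_pdivrMr// mulrC.
Qed.

Lemma posdefmx_coercive K : posdefmx K ->
  exists2 c : R, 0 < c & forall v, c * (\sum_j v 0 j ^+ 2) <= qform K v.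
Proof.
(* The coordinate bounds add up to the trace of the inverse; the extra 1 keeps [S] positive when
   [n = 0]. *)
move=> pK; pose S := 1 + \sum_j invmx K j j.
have S0 : 0 < S.
  by rewrite ltr_wpDr// sumr_ge0// => j _; exact/ltW/invmx_diag_gt0.
exists S^-1; first by rewrite invr_gt0.
move=> v; rewrite mulrC ler_pdivrMr// mulrDr mulr1 mulr_sumr.
rewrite ler_wpDl//.
  have [->|v0] := eqVneq v 0; first by rewrite /qform !mul0mx mxE.
  by apply/ltW; apply: (pK.2).
by apply: ler_sum => j _; rewrite mulrC; exact: qform_coord_le.
Qed.

(** Exponent of the joint density in the decomposition [v = Y + g u], where Sherman-Morrison gives
    [g] the precision [(1 + s b) / s]. The right side factors the same density into the conditional
    law of [g] given [v] and the law of [v]. *)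
Lemma qform_complete_square K j s v g : posdefmx K -> 0 < s ->
  let b := invmx K j j in
  (1 + s * b) / s * g ^+ 2
  + qform (K + s *: delta_mx j j) (v - g *: row j (invmx K)) =
  (1 + s * b) ^+ 2 / s * (g - s / (1 + s * b) * v 0 j) ^+ 2 + qform K v.
Proof.
move=> pK s0 b; have b0 : 0 < b by exact: invmx_diag_gt0.
have sb0 : 1 + s * b != 0 by rewrite gt_eqF// ltr_wpDr// mulr_ge0// ltW.
rewrite qformD -scaleNr qform_shift// -/b !mxE -/b.
by field; rewrite sb0 gt_eqF.
Qed.

End quadratic_form.

(** * One-dimensional integrals and the Gaussian mixture *)

Section one_dim_integrals.
Local Open Scope ereal_scope.
Context (R : realType).
Notation leb := (@lebesgue_measure R).

Lemma integral_gaussian (a b : R) : (0 < a)%R ->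
  \int[leb]_x (expR (- 2^-1 * (a * (x - b) ^+ 2)))%:E
  = (Num.sqrt (2 * pi / a))%:E.
Proof.
move=> a0; pose s : R := (Num.sqrt a)^-1%R.
have s0 : (s != 0)%R by rewrite invr_eq0 gt_eqF// sqrtr_gt0.
have s2 : (s ^+ 2 = a^-1)%R by rewrite exprVn sqr_sqrtr// ltW.
have p0 := normal_peak_gt0 s0.
have fE x : (expR (- 2^-1 * (a * (x - b) ^+ 2)) =
    (normal_peak s)^-1 * normal_pdf b s x)%R.
  rewrite normal_pdfE// mulKf ?gt_eqF// /normal_fun s2; congr expR.
  by field; rewrite gt_eqF.
under eq_integral do rewrite fE EFinM.
rewrite ge0_integralZl//; last 3 first.
- by apply/measurable_EFinP; exact: measurable_normal_pdf.
- by move=> x _; rewrite lee_fin normal_pdf_ge0.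
- by rewrite lee_fin invr_ge0 ltW.
rewrite integral_normal_pdf mule1 /normal_peak invrK s2; congr (Num.sqrt _)%:E.
by field; rewrite gt_eqF.
Qed.

(** Provides the majorant for integrals over the mixing variable, which ranges over the whole
    line. *)
Lemma integral_expR_norm (k : R) : (0 < k)%R ->
  \int[leb]_x (expR (- k * `|x|))%:E < +oo.
Proof.
move=> k0.
have me : measurable_fun [set: R] (fun x => (exponential_pdf k x)%:E).
  by apply/measurable_EFinP; exact: measurable_exponential_pdf.
have e0 x : 0 <= (exponential_pdf k x)%:E.
  by rewrite lee_fin exponential_pdf_ge0// ltW.
have meN : measurable_fun [set: R] (fun x => (exponential_pdf k (- x))%:E).
  by apply: (measurableT_comp me).
have mf : measurable_fun [set: R] (fun x => (expR (- k * `|x|))%:E).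
  apply/measurable_EFinP; apply: measurableT_comp => //.
  exact: measurable_funM.
apply: (@le_lt_trans _ _ (\int[leb]_x
    (k^-1%:E * ((exponential_pdf k x)%:E + (exponential_pdf k (- x))%:E)))).
  apply: ge0_le_integral => //.
  - by apply: measurable_funeM; exact: emeasurable_funD.
  - move=> x _; rewrite -EFinD -EFinM lee_fin ler_pdivlMl//.
    have [x0|x0] := leP 0%R x.
      rewrite exponential_pdfE// ger0_norm// lerDl.
      by rewrite exponential_pdf_ge0// ltW.
    have xN0 : (0 <= - x)%R by rewrite oppr_ge0 ltW.
    rewrite (exponential_pdfE k xN0).
    by rewrite ltr0_norm// lerDr exponential_pdf_ge0// ltW.
rewrite ge0_integralZl//; last 3 first.
- exact: emeasurable_funD.
- by move=> x _; rewrite adde_ge0.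
- by rewrite lee_fin invr_ge0 ltW.
rewrite ge0_integralD// (integral_lebesgue_opp me)//.
by rewrite integral_exponential_pdf// -EFinD -EFinM ltry.
Qed.

Lemma measurable_mixture (nu : R) (a : R) :
  measurable_fun [set: R] (fun y => (expR (nu * y - expR y * a))%:E).
Proof.
apply/measurable_EFinP; apply: measurableT_comp => //.
apply: measurable_funB; first exact: measurable_funM.
by apply: measurable_funM => //; exact: measurable_expR.
Qed.

Lemma expR_ge_sqr (y : R) : (0 <= y -> y ^+ 2 / 4 <= expR y)%R.
Proof.
move=> y0; rewrite (_ : y = y / 2 + y / 2)%R; last by field.
rewrite expRD -expr2 (_ : _ / 4 = (y / 2) ^+ 2)%R; last by field.
rewrite ler_sqr ?nnegrE ?expR_ge0 ?divr_ge0//.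
by apply: le_trans (expR_ge1Dx _); rewrite lerDr.
Qed.

(* The substitution [s = e^y] in the Gamma integral turns the scaling in [x]
   into a translation. *)
Lemma powR_gaussian_mixture (nu : R) : (0 < nu)%R ->
  exists2 C : R, (0 < C)%R & forall x : R, x != 0%R ->
    \int[leb]_y (expR (nu * y - expR y * (2^-1 * x ^+ 2)))%:E
    = (C * `|x| `^ (- 2 * nu))%:E.
Proof.
move=> nu0.
pose G (y : R) := (expR (nu * y - expR y * 2^-1))%:E.
have mG : measurable_fun [set: R] G by exact: measurable_mixture.
have G0 y : 0 <= G y by rewrite lee_fin expR_ge0.
have Gfin : \int[leb]_y G y < +oo.
  (* For [y >= 0] the bound amounts to [2 nu y - e^y / 2 <= 8 nu^2]; since [y^2 / 8 <= e^y / 2], it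
     follows from [(y - 8 nu)^2 >= 0]. For [y < 0] the factor [e^(nu y)] is itself the decay. *)
  apply: (@le_lt_trans _ _ (\int[leb]_y
      ((expR (8 * nu ^+ 2))%:E * (expR (- nu * `|y|))%:E))).
    apply: ge0_le_integral => //.
      apply: measurable_funeM; apply/measurable_EFinP.
      apply: measurableT_comp => //.
      exact: measurable_funM.
    move=> y _; rewrite -EFinM lee_fin -expRD ler_expR.
    have [y0|y0] := leP 0%R y.
      rewrite ger0_norm//; have := expR_ge_sqr y0.
      have : (0 <= (y - 8 * nu) ^+ 2)%R by exact: sqr_ge0.
      nra.
    rewrite ltr0_norm//; have := expR_ge0 y; have : (0 <= nu ^+ 2)%R by exact: sqr_ge0.
    lra.
  rewrite ge0_integralZl//.
  - by rewrite lte_mul_pinfty ?integral_expR_norm// lee_fin expR_ge0.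
  - apply/measurable_EFinP; apply: measurableT_comp => //.
    exact: measurable_funM.
have Gpos : 0 < \int[leb]_y G y.
  apply: (@lt_le_trans _ _ (\int[leb]_(y in `[0%R, 1%R]) (expR (- expR 1))%:E)).
    rewrite integral_cst//= lebesgue_measure_itv/= lte01 sube0 mule1.
    by rewrite lte_fin expR_gt0.
  apply: (@le_trans _ _ (\int[leb]_(y in `[0%R, 1%R]) G y)); last first.
    exact: ge0_subset_integral.
  apply: ge0_le_integral => //.
  - exact: measurable_funS mG.
  - move=> y; rewrite /= in_itv/= => /andP[y0 y1]; rewrite lee_fin ler_expR.
    have : (expR y <= expR 1)%R by rewrite ler_expR.
    have := expR_ge0 y; have := mulr_ge0 (ltW nu0) y0; lra.
exists (fine (\int[leb]_y G y)); first by apply: fine_gt0; rewrite Gpos Gfin.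
move=> x x0; have x0' : (0 < `|x|)%R by rewrite normr_gt0.
(* Shifting [y] by [-2 ln |x|] divides [e^y] by [x^2], which removes [x] from the second term and
   releases the factor [|x|^(-2 nu)]. *)
rewrite -(integral_lebesgue_shift (- 2 * ln `|x|)%R (measurable_mixture nu _)); last first.
  by move=> y; rewrite lee_fin expR_ge0.
rewrite /powR gt_eqF// EFinM fineK ?ge0_fin_numE//; last exact: integral_ge0.
rewrite muleC -ge0_integralZl//.
apply: eq_integral => y _; rewrite -EFinM -expRD; congr (expR _)%:E.
have -> : (expR (y + - 2 * ln `|x|) = expR y / x ^+ 2)%R.
  rewrite expRD mulNr expRN mulr2n mulrDl mul1r expRD lnK ?posrE//.
  by rewrite -expr2 real_normK ?num_real.
by field.
Qed.

(** After the mixture and Tonelli, the integrand in [y] is [e^(nu y)] times a constant multiple of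
    [(e^y + c)^(-1/2)]. It decays like [e^(nu y)] at minus infinity and like [e^(-(1/2 - nu) y)] at
    plus infinity, which is where [nu < 1/2] is used. *)
Lemma integral_powR_gaussian (nu c : R) : (0 <= nu < 1 / 2)%R -> (0 < c)%R ->
  \int[leb]_x (`|x| `^ (- 2 * nu) * expR (- 2^-1 * (c * x ^+ 2)))%:E < +oo.
Proof.
move=> /andP[]; rewrite le_eqVlt => /predU1P[<- _ c0|nu0 nu2 c0].
  have E x : ((`|x| `^ (- 2 * 0) * expR (- 2^-1 * (c * x ^+ 2)))%:E =
      (expR (- 2^-1 * (c * (x - 0) ^+ 2)))%:E :> \bar R)%R.
    by rewrite mulr0 powRr0 mul1r subr0.
  under eq_integral do rewrite E.
  by rewrite integral_gaussian// ltry.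
have [C C0 mixE] := powR_gaussian_mixture nu0.
have mpow : measurable_fun [set: R] (fun x => `|x| `^ (- 2 * nu))%R.
  apply: (@measurableT_comp _ _ _ _ _ _ (fun x : R => x `^ (- 2 * nu))%R).
    exact: measurable_powR.
  exact: normr_measurable.
have mg : measurable_fun [set: R] (fun x => expR (- 2^-1 * (c * x ^+ 2)))%R.
  apply: measurableT_comp => //; apply: measurable_funM => //.
  by apply: measurable_funM => //; exact: measurable_funX.
pose F (z : R * R) := (expR (nu * z.2 - expR z.2 * (2^-1 * z.1 ^+ 2)) *
  expR (- 2^-1 * (c * z.1 ^+ 2)))%:E.
have F0 z : 0 <= F z by rewrite lee_fin mulr_ge0 ?expR_ge0.
have mF : measurable_fun [set: R * R] F.
  apply/measurable_EFinP; apply: measurable_funM.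
    apply: measurableT_comp => //; apply: measurable_funB.
      exact: measurable_funM.
    apply: measurable_funM; first exact: measurableT_comp.
    by apply: measurable_funM => //; exact: measurable_funX.
  exact: (measurableT_comp mg).
(* [k] is the slower of the two decay rates. In [D], the term 1 serves for [y >= 0] and the term in
   [c] for [y < 0]. *)
pose k := Num.min nu (1 / 2 - nu)%R.
have k0 : (0 < k)%R by rewrite /k lt_min nu0 subr_gt0.
pose D := (Num.sqrt (2 * pi) * (1 + Num.sqrt c^-1))%R.
have D0 : (0 <= D)%R by rewrite mulr_ge0// addr_ge0.
pose g (x : R) := (`|x| `^ (- 2 * nu) * expR (- 2^-1 * (c * x ^+ 2)))%:E.
have mgE : measurable_fun [set: R] g.
  by apply/measurable_EFinP; exact: measurable_funM.
have g0 x : 0 <= g x by rewrite lee_fin mulr_ge0 ?powR_ge0 ?expR_ge0.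
have CE0 : 0 <= C%:E by rewrite lee_fin ltW.
rewrite -/(\int[leb]_x g x) -(@lte_pmul2l _ C%:E)// gt0_muley ?lte_fin//.
rewrite -ge0_integralZl//.
have mF1 : measurable_fun [set: R] (fun x => \int[leb]_y F (x, y)).
  exact: (measurable_fun_fubini_tonelli_F (m2 := leb) F mF F0).
apply: (@le_lt_trans _ _ (\int[leb]_x \int[leb]_y F (x, y))).
  apply: ge0_le_integral => //.
  - by move=> x _; rewrite mule_ge0.
  - exact: measurable_funeM.
  (* At [x = 0] the power is 0 by default while the mixture diverges, so the integrands are compared
     by an inequality. *)
  move=> x _; have [->|x0] := eqVneq x 0%R.
    rewrite normr0 powR0 ?mul0r ?mule0 ?integral_ge0//.
    by rewrite mulf_neq0// ?gt_eqF// oppr_eq0.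
  have FE y : F (x, y) = (expR (nu * y - expR y * (2^-1 * x ^+ 2)))%:E *
      (expR (- 2^-1 * (c * x ^+ 2)))%:E by [].
  under eq_integral do rewrite FE.
  have mm := measurable_mixture nu (2^-1 * x ^+ 2).
  rewrite ge0_integralZr//.
  by rewrite mixE// -!EFinM mulrA.
have -> : \int[leb]_x \int[leb]_y F (x, y) = \int[leb]_y \int[leb]_x F (x, y).
  exact: (fubini_tonelli (m1 := leb) (m2 := leb) F mF F0).
apply: (@le_lt_trans _ _ (\int[leb]_y (D%:E * (expR (- k * `|y|))%:E))).
  apply: ge0_le_integral; [by []| | | |].
  - by move=> y _; exact: integral_ge0.
  - exact: (measurable_fun_fubini_tonelli_G (m1 := leb) F mF F0).
  - apply: measurable_funeM; apply/measurable_EFinP.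
    apply: measurableT_comp => //.
    exact: measurable_funM.
  move=> y _; have ec : (0 < expR y + c)%R by rewrite addr_gt0 ?expR_gt0.
  have -> : \int[leb]_x F (x, y) =
      \int[leb]_x ((expR (nu * y))%:E *
        (expR (- 2^-1 * ((expR y + c) * (x - 0) ^+ 2)))%:E).
    apply: eq_integral => x _; rewrite /F/= -EFinM -!expRD; congr (expR _)%:E.
    by rewrite subr0; ring.
  rewrite ge0_integralZl//; last first.
    apply/measurable_EFinP; apply: measurableT_comp => //.
    apply: measurable_funM => //; apply: measurable_funM => //.
    by apply: measurable_funX; exact: measurable_funB.
  rewrite integral_gaussian// -!EFinM lee_fin /D sqrtrM; last by rewrite mulr_ge0// pi_ge0.
  rewrite mulrCA -mulrA ler_wpM2l//.
  have kE : (expR (nu * y) * Num.sqrt (expR y + c)^-1 <=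
     (1 + Num.sqrt c^-1) * expR (- k * `|y|))%R.
    have [y0|y0] := leP 0%R y.
      rewrite ger0_norm//.
      have h1 : (Num.sqrt (expR y + c)^-1 <= expR (- (y / 2)))%R.
        rewrite -[leRHS]ger0_norm ?expR_ge0// -sqrtr_sqr ler_sqrt.
          rewrite expr2 -expRD (_ : - (y / 2) + - (y / 2) = - y)%R; last by field.
          by rewrite expRN lef_pV2 ?posrE ?expR_gt0// lerDl ltW.
        by rewrite sqr_ge0.
      apply: (@le_trans _ _ (1 * expR (- k * y)))%R; last first.
        by rewrite ler_wpM2r ?expR_ge0// lerDl.
      rewrite mul1r; apply: (le_trans (ler_wpM2l (expR_ge0 _) h1)).
      rewrite -expRD ler_expR.
      have : (k <= 1 / 2 - nu)%R by rewrite /k ge_min lexx orbT.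
      nra.
    rewrite ltr0_norm//.
    have h1 : (Num.sqrt (expR y + c)^-1 <= Num.sqrt c^-1)%R.
      rewrite ler_sqrt ?invr_ge0 ?(ltW c0)//.
      by rewrite lef_pV2 ?posrE// lerDr expR_ge0.
    apply: (@le_trans _ _ (Num.sqrt c^-1 * expR (nu * y)))%R.
      by rewrite mulrC ler_wpM2r ?expR_ge0.
    apply: ler_pM => //; rewrite ?expR_ge0 ?sqrtr_ge0 ?lerDr// ler_expR.
    have : (k <= nu)%R by rewrite /k ge_min lexx.
    nra.
  exact: kE.
rewrite ge0_integralZl//.
- by rewrite lte_mul_pinfty ?integral_expR_norm// lee_fin.
- apply/measurable_EFinP; apply: measurableT_comp => //.
  exact: measurable_funM.
Qed.

End one_dim_integrals.

(** * Integration against a measure with a density *)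

Section density.
Local Open Scope ereal_scope.
Context d (T : measurableType d) (R : realType).
Variables (mu nu : {measure set T -> \bar R}) (f : T -> R).
Hypothesis mf : measurable_fun [set: T] f.
Hypothesis f0 : forall x, (0 <= f x)%R.
Hypothesis nuE : forall A, measurable A -> nu A = \int[mu]_(x in A) (f x)%:E.

Import HBNNSimple.

Let mfE : measurable_fun [set: T] (EFin \o f).
Proof. exact/measurable_EFinP. Qed.

Let integral_density_nnsfun (g : {nnsfun T >-> R}) :
  \int[nu]_x (g x)%:E = \int[mu]_x ((g x)%:E * (f x)%:E).
Proof.
have indic r : measurable_fun [set: T] (fun x => (r * \1_(g @^-1` [set r]) x)%:E).
  by apply/measurable_EFinP; exact: measurable_funM.
transitivity (\int[nu]_x (\sum_(y \in range g) (y * \1_(g @^-1` [set y]) x)%:E)).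
  by apply: eq_integral => t _; rewrite fimfunE -fsumEFin.
rewrite ge0_integral_fsum//; last by move=> m y _; exact: nnfun_muleindic_ge0.
transitivity (\int[mu]_x (\sum_(y \in range g)
    (y * \1_(g @^-1` [set y]) x)%:E * (f x)%:E)); last first.
  apply: eq_integral => x _.
  rewrite -ge0_mule_fsuml => [|y]; last exact: nnfun_muleindic_ge0.
  by rewrite fsumEFin // -(fimfunE _ x).
rewrite ge0_integral_fsum//; last 2 first.
  - by move=> y; apply: emeasurable_funM.
  - by move=> m y _; apply: mule_ge0; [exact: nnfun_muleindic_ge0|rewrite lee_fin].
apply: eq_fsbigr => r rg.
under [LHS]eq_integral do rewrite EFinM.
rewrite integralZl_indic_nnsfun//.
under [RHS]eq_integral do rewrite EFinM -muleA.
have mr : measurable (g @^-1` [set r]) by exact: measurable_funPTI.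
rewrite ge0_integralZl//.
- rewrite integral_indic// setIT nuE//; congr (_ * _).
  rewrite integral_mkcond; apply: eq_integral => x _.
  by rewrite patchE indicE; case: ifPn => _; rewrite ?mul1e ?mul0e.
- by apply: emeasurable_funM => //; exact/measurable_EFinP.
- by move=> t _; rewrite mule_ge0 ?lee_fin.
- by move: rg; rewrite inE => -[t _ <-]; rewrite lee_fin.
Qed.

Lemma ge0_integral_density (h : T -> \bar R) :
  measurable_fun [set: T] h -> (forall x, 0 <= h x) ->
  \int[nu]_x h x = \int[mu]_x (h x * (f x)%:E).
Proof.
move=> mh h0; pose g := nnsfun_approx measurableT mh.
have gh x : h x = lim ((g n x)%:E @[n --> \oo]).
  by apply/esym/cvg_lim => //; exact: cvg_nnsfun_approx.
have ghf x : h x * (f x)%:E = lim ((g n x)%:E * (f x)%:E @[n --> \oo]).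
  by apply/esym/cvg_lim => //; apply: cvgeZr => //; exact: cvg_nnsfun_approx.
under eq_integral do rewrite gh.
under [RHS]eq_integral do rewrite ghf.
rewrite monotone_convergence//; last 3 first.
- by move=> n; exact/measurable_EFinP.
- by move=> n x _; rewrite lee_fin.
- by move=> x _ a b ab; rewrite lee_fin; exact/lefP/nd_nnsfun_approx.
rewrite monotone_convergence//; last 3 first.
- by move=> n; apply: emeasurable_funM => //; exact/measurable_EFinP.
- by move=> n x _; rewrite mule_ge0 ?lee_fin.
- move=> x _ a b ab; rewrite lee_wpmul2r ?lee_fin//.
  exact/lefP/nd_nnsfun_approx.
by under eq_fun do rewrite integral_density_nnsfun.
Qed.

End density.

(** * Gaussian integrals and rank-one tilts *)

Section gaussian_weight.
Context (R : realType) (n : nat).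
Notation leb := (@lebesgue_measure R).
Notation lebn := (@lebesgue_tuple R n).
Implicit Types (K : 'M[R]_n) (x : n.-tuple R) (j : 'I_n).

(** [K] is the precision, not the covariance, so that a tilt by [exp(- s x_j^2 / 2)] just adds [s]
    to a diagonal entry. *)
Definition gauss_weight K x : R := expR (- 2^-1 * qform K (\row_i tnth x i)).

Lemma gauss_weight_gt0 K x : 0 < gauss_weight K x.
Proof. exact: expR_gt0. Qed.

Lemma measurable_gauss_weight K : measurable_fun [set: n.-tuple R] (gauss_weight K).
Proof.
apply: measurableT_comp => //; apply: measurable_funM => //.
rewrite (_ : (fun _ => _) =
    (fun x => \sum_i (\sum_k tnth x k * K k i) * tnth x i)); last first.
  apply/funext => x; rewrite /qform mxE; apply: eq_bigr => i _.
  by rewrite !mxE; congr (_ * _); apply: eq_bigr => k _; rewrite mxE.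
apply: measurable_sum => i; apply: measurable_funM; last exact: measurable_coord.
by apply: measurable_sum => k; apply: measurable_funM => //; exact: measurable_coord.
Qed.

Lemma gauss_weightD K s j x : gauss_weight (K + s *: delta_mx j j) x =
  gauss_weight K x * expR (- 2^-1 * (s * tnth x j ^+ 2)).
Proof. by rewrite /gauss_weight qformD mxE mulrDr expRD. Qed.

Local Open Scope ereal_scope.

Definition gauss_int K (f : n.-tuple R -> R) : \bar R :=
  \int[lebn]_x (f x * gauss_weight K x)%:E.

Definition line (u : 'I_n -> R) x (g : R) : n.-tuple R :=
  [tuple (tnth x i + g * u i)%R | i < n].

Lemma measurable_line u :
  measurable_fun [set: n.-tuple R * R] (fun z => line u z.1 z.2).
Proof.
apply/measurable_fun_tnthP => i.
rewrite (_ : _ \o _ = (fun z : n.-tuple R * R => tnth z.1 i + z.2 * u i)%R).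
  apply: measurable_funD; last exact: measurable_funM.
  by apply: (@measurableT_comp _ _ _ _ _ _ (fun x => tnth x i)) => //;
    exact: measurable_coord.
by apply/funext => z /=; rewrite tnth_mktuple.
Qed.

Lemma line_convex u (f : n.-tuple R -> R) x g : tuple_convex f ->
  (f x + f x <= f (line u x g) + f (line u x (- g)))%R.
Proof.
move=> cf; have h01 : (0 <= (2^-1 : R) <= 1)%R by apply/andP; split; lra.
have := cf _ (line u x g) (line u x (- g)) h01.
rewrite (_ : [tuple _ | _ < _] = x); first by lra.
by apply: eq_from_tnth => i; rewrite !tnth_mktuple; field.
Qed.

(* [g - 0] is the shape in which [integral_gaussian] applies. *)
Definition scalar_weight (a g : R) : R := expR (- 2^-1 * (a * (g - 0) ^+ 2)).

Let mE a : measurable_fun [set: R] (scalar_weight a).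
Proof.
apply: measurableT_comp => //; apply: measurable_funM => //.
by apply: measurable_funM => //; apply: measurable_funX; exact: measurable_funB.
Qed.

Let mEE a : measurable_fun [set: R] (fun g => (scalar_weight a g)%:E).
Proof. by apply/measurable_EFinP; exact: mE. Qed.

Lemma measurable_weighted K (f : n.-tuple R -> R) :
  measurable_fun [set: n.-tuple R] f ->
  measurable_fun [set: n.-tuple R] (fun x => (f x * gauss_weight K x)%:E).
Proof.
move=> mf; apply/measurable_EFinP; apply: measurable_funM => //.
exact: measurable_gauss_weight.
Qed.

Lemma weighted_ge0 K (f : n.-tuple R -> R) : (forall y, 0 <= f y)%R ->
  forall x, 0 <= (f x * gauss_weight K x)%:E.
Proof. by move=> f0 x; rewrite lee_fin mulr_ge0// ltW// gauss_weight_gt0. Qed.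

Let mline1 u x : measurable_fun [set: R] (line u x).
Proof. exact: (measurableT_comp (measurable_line u) (pair1_measurable x)). Qed.

(** Jensen's inequality for an even weight: [g] is paired with [-g] and midpoint convexity applied.
    Doubling the integral makes both signs appear; an infinite value is trivial. *)
Lemma integral_line_ge u (f : n.-tuple R -> R) x a : (0 < a)%R ->
  measurable_fun [set: n.-tuple R] f -> (forall y, 0 <= f y)%R ->
  tuple_convex f ->
  (Num.sqrt (2 * pi / a) * f x)%:E <=
  \int[leb]_g (scalar_weight a g * f (line u x g))%:E.
Proof.
move=> a0 mf f0 cf; set M := \int[leb]_g _.
have mF : measurable_fun [set: R] (fun g => (scalar_weight a g * f (line u x g))%:E).
  apply/measurable_EFinP; apply: measurable_funM => //.
  exact: measurableT_comp.
have F0 g : 0 <= (scalar_weight a g * f (line u x g))%:E.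
  by rewrite lee_fin mulr_ge0 ?expR_ge0.
have mFN : measurable_fun [set: R]
    (fun g => (scalar_weight a (- g) * f (line u x (- g)))%:E).
  exact: (measurableT_comp mF).
have MN : M = \int[leb]_g (scalar_weight a (- g) * f (line u x (- g)))%:E.
  by rewrite (integral_lebesgue_opp mF).
have M2 : M + M = \int[leb]_g ((scalar_weight a g * f (line u x g))%:E +
    (scalar_weight a (- g) * f (line u x (- g)))%:E).
  by rewrite ge0_integralD// -MN.
have : (Num.sqrt (2 * pi / a) * (f x + f x))%:E <= M + M.
  have ff0 : 0 <= (f x + f x)%:E by rewrite lee_fin addr_ge0.
  have mEa : measurable_fun [set: R]
    (fun g : R => (expR (- 2^-1 * (a * (g - 0) ^+ 2)))%:E) := mEE a.
  rewrite M2 EFinM -(integral_gaussian 0 a0) -ge0_integralZr//.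
  apply: ge0_le_integral => //.
  - by move=> g _; rewrite -EFinM lee_fin mulr_ge0 ?expR_ge0// addr_ge0.
  - apply: emeasurable_funM => //; by apply/measurable_EFinP; exact: mE.
  - exact: emeasurable_funD.
  - move=> g _; rewrite -EFinM -EFinD lee_fin.
    rewrite (_ : scalar_weight a (- g) = scalar_weight a g); last first.
      by rewrite /scalar_weight !subr0 sqrrN.
    rewrite -[X in (X * _ <= _)%R]/(scalar_weight a g) -mulrDr ler_wpM2l ?expR_ge0//.
    exact: line_convex.
have : 0 <= M by exact: integral_ge0.
case: M {MN M2} => [m| |]//=; last by move=> *; rewrite leey.
by rewrite -EFinD !lee_fin; lra.
Qed.

(* [N(0, K^-1)] is the law of [Y + g u] where [Y] has precision matrix
   [K + s *: delta_mx j j] and [g] is an independent scalar Gaussian variable: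
   the law with the larger precision is smaller in the convex order. *)
Lemma gauss_int_line K j s (f : n.-tuple R -> R) :
  let b := invmx K j j in
  posdefmx K -> (0 < s)%R ->
  measurable_fun [set: n.-tuple R] f -> (forall y, 0 <= f y)%R ->
  (Num.sqrt (2 * pi / ((1 + s * b) ^+ 2 / s)))%:E * gauss_int K f =
  \int[lebn]_x ((gauss_weight (K + s *: delta_mx j j) x)%:E *
    \int[leb]_g (scalar_weight ((1 + s * b) / s) g * f (line (invmx K j) x g))%:E).
Proof.
move=> b pK s0 mf f0; set K' := (K + _)%R; set al := ((1 + s * b) / s)%R.
set ga := ((1 + s * b) ^+ 2 / s)%R; set u := invmx K j.
have b0 : (0 < b)%R by exact: invmx_diag_gt0.
have sb0 : (0 < 1 + s * b)%R by rewrite addr_gt0// mulr_gt0.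
have ga0 : (0 < ga)%R by rewrite divr_gt0// exprn_gt0.
have mw := measurable_gauss_weight K; have mw' := measurable_gauss_weight K'.
pose H (z : n.-tuple R * R) :=
  (f z.1 * scalar_weight al z.2 * gauss_weight K' (line u z.1 (- z.2)))%:E.
have H0 z : 0 <= H z.
  by rewrite lee_fin !mulr_ge0 ?expR_ge0// ltW// gauss_weight_gt0.
have mH : measurable_fun [set: n.-tuple R * R] H.
  apply/measurable_EFinP; apply: measurable_funM.
    by apply: measurable_funM; exact: measurableT_comp.
  apply: measurableT_comp => //.
  rewrite (_ : (fun z => _) = (fun z => line (fun i => - u i)%R z.1 z.2)).
    exact: measurable_line.
  apply/funext => z; apply: eq_from_tnth => i.
  by rewrite !tnth_mktuple mulrN mulNr.
pose H' (z : n.-tuple R * R) :=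
  (gauss_weight K' z.1 * (scalar_weight al z.2 * f (line u z.1 z.2)))%:E.
have H'0 z : 0 <= H' z.
  by rewrite lee_fin !mulr_ge0 ?expR_ge0// ltW// gauss_weight_gt0.
have mH' : measurable_fun [set: n.-tuple R * R] H'.
  apply/measurable_EFinP; apply: measurable_funM; first exact: measurableT_comp.
  apply: measurable_funM; first exact: measurableT_comp.
  by apply: measurableT_comp => //; exact: measurable_line.
(* The scalar on the left is the integral over [g] of the conditional Gaussian centered at [m];
   completing the square makes the product a double integral. *)
transitivity (\int[lebn]_x \int[leb]_g H (x, g)).
  have B0 : 0 <= (Num.sqrt (2 * pi / ga))%:E by rewrite lee_fin.
  have mfK := measurable_weighted K mf; have fK0 := weighted_ge0 K f0.
  rewrite /gauss_int -ge0_integralZl//.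
  apply: eq_integral => x _.
  pose m := (s / (1 + s * b) * tnth x j)%R.
  have mG : measurable_fun [set: R]
      (fun g : R => (expR (- 2^-1 * (ga * (g - m) ^+ 2)))%:E).
    apply/measurable_EFinP; apply: measurableT_comp => //.
    apply: measurable_funM => //; apply: measurable_funM => //.
    by apply: measurable_funX; exact: measurable_funB.
  rewrite -(integral_gaussian m ga0) -ge0_integralZr//.
  apply: eq_integral => g _; rewrite /H/= -EFinM; congr EFin.
  rewrite mulrCA -mulrA; congr (_ * _)%R.
  rewrite /scalar_weight /gauss_weight -!expRD; congr expR.
  have := qform_complete_square j (\row_i tnth x i) g pK s0.
  rewrite -/b -/al -/ga mxE => sq.
  rewrite (_ : \row_i tnth (line u x (- g)) i =
     \row_i tnth x i - g *: row j (invmx K))%R; last first.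
    by apply/rowP => i; rewrite !mxE tnth_mktuple mulNr.
  by rewrite subr0 -!mulrDr sq.
rewrite (fubini_tonelli (m1 := lebn) (m2 := leb) H mH H0).
transitivity (\int[leb]_g \int[lebn]_x H' (x, g)).
  apply: eq_integral => g _.
  pose F x := H (x, g).
  rewrite -[LHS]/(\int[lebn]_x F x).
  have mF : measurable_fun [set: n.-tuple R] F.
    exact: (measurableT_comp mH (pair2_measurable g)).
  have F0 x : 0 <= F x by exact: H0.
  (* For fixed [g], translation by [g u] undoes [line u x (- g)]: the variable is now [Y]. *)
  rewrite -(lebesgue_tuple_shift (fun i => g * u i)%R mF F0).
  apply: eq_integral => x _; rewrite /F /H /H'/=.
  rewrite -/(line u x g) (_ : line u (line u x g) (- g) = x).
    by congr EFin; ring.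
  by apply: eq_from_tnth => i; rewrite !tnth_mktuple; ring.
rewrite -(fubini_tonelli (m1 := lebn) (m2 := leb) H' mH' H'0).
apply: eq_integral => x _; rewrite /H'/=.
have ml : measurable_fun [set: R] (fun g => (scalar_weight al g * f (line u x g))%:E).
  apply/measurable_EFinP; apply: measurable_funM => //.
  exact: measurableT_comp.
have l0 g : 0 <= (scalar_weight al g * f (line u x g))%:E.
  by rewrite lee_fin mulr_ge0 ?expR_ge0.
have w0 : 0 <= (gauss_weight K' x)%:E by rewrite lee_fin ltW// gauss_weight_gt0.
by rewrite -ge0_integralZl.
Qed.

(** [r] is the ratio of total masses, equal to [(1 + s b)^(-1/2)]. Since it serves the constant 1
    with equality and every convex [f] with an inequality, normalized integrals of [f] decrease. *)
Lemma gauss_int_step K j s : posdefmx K -> (0 < s)%R ->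
  exists2 r : R, (0 < r)%R &
    gauss_int (K + s *: delta_mx j j) (cst 1%R) = r%:E * gauss_int K (cst 1%R) /\
    forall f : n.-tuple R -> R, measurable_fun [set: n.-tuple R] f ->
      (forall y, 0 <= f y)%R -> tuple_convex f ->
      gauss_int (K + s *: delta_mx j j) f <= r%:E * gauss_int K f.
Proof.
move=> pK s0; have b0 := invmx_diag_gt0 j pK; set b := invmx K j j in b0.
have sb0 : (0 < 1 + s * b)%R by rewrite addr_gt0// mulr_gt0.
pose al := ((1 + s * b) / s)%R; pose ga := ((1 + s * b) ^+ 2 / s)%R.
have al0 : (0 < al)%R by rewrite divr_gt0.
have ga0 : (0 < ga)%R by rewrite divr_gt0// exprn_gt0.
pose A : R := Num.sqrt (2 * pi / al); pose B : R := Num.sqrt (2 * pi / ga).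
have A0 : (0 < A)%R by rewrite sqrtr_gt0 divr_gt0// mulr_gt0// pi_gt0.
have B0 : (0 < B)%R by rewrite sqrtr_gt0 divr_gt0// mulr_gt0// pi_gt0.
have mw' := measurable_gauss_weight (K + s *: delta_mx j j).
have rE (X Y : \bar R) : B%:E * X = A%:E * Y -> Y = (A^-1 * B)%:E * X.
  by move=> XY; rewrite EFinM -muleA XY muleA -EFinM mulVf ?mul1e// gt_eqF.
have AIE (f : n.-tuple R -> R) :
    measurable_fun [set: n.-tuple R] f -> (forall y, 0 <= f y)%R ->
  A%:E * gauss_int (K + s *: delta_mx j j) f =
  \int[lebn]_x ((gauss_weight (K + s *: delta_mx j j) x)%:E * (A * f x)%:E).
  move=> mf f0; have AE0 : 0 <= A%:E by rewrite lee_fin ltW.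
  have mfK := measurable_weighted (K + s *: delta_mx j j) mf.
  have fK0 := weighted_ge0 (K + s *: delta_mx j j) f0.
  rewrite /gauss_int -ge0_integralZl//.
  by apply: eq_integral => x _; rewrite -!EFinM; congr EFin; ring.
exists (A^-1 * B)%R; first by rewrite mulr_gt0// invr_gt0.
split.
  apply: rE; rewrite AIE// (gauss_int_line _ pK)//; apply: eq_integral => x _.
  congr (_ * _); under eq_integral do rewrite mulr1.
  by rewrite integral_gaussian// mulr1.
move=> f mf f0 cf.
have : A%:E * gauss_int (K + s *: delta_mx j j) f <= B%:E * gauss_int K f.
  rewrite AIE// (gauss_int_line _ pK)//.
  apply: ge0_le_integral => //.
  - move=> x _; rewrite -EFinM lee_fin !mulr_ge0 ?(ltW A0)// ltW// gauss_weight_gt0//.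
  - by apply/measurable_EFinP; apply: measurable_funM => //; exact: measurable_funM.
  - apply: emeasurable_funM; first exact/measurable_EFinP.
    apply: (measurable_fun_fubini_tonelli_F (m2 := leb)
      (fun z : n.-tuple R * R =>
         (scalar_weight al z.2 * f (line (invmx K j) z.1 z.2))%:E)).
      apply/measurable_EFinP; apply: measurable_funM; first exact: measurableT_comp.
      by apply: measurableT_comp => //; exact: measurable_line.
    by move=> z; rewrite lee_fin mulr_ge0 ?expR_ge0.
  - move=> x _; apply: lee_wpmul2l; first by rewrite lee_fin ltW// gauss_weight_gt0.
    exact: integral_line_ge.
rewrite EFinM -muleA => h.
rewrite -(@lee_pmul2l _ A%:E) ?lte_fin//.
by rewrite muleA -EFinM divff ?gt_eqF// mul1e.
Qed.

End gaussian_weight.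

(** * Weights by powers of coordinates *)

Section powR_weight.
Context (R : realType) (n : nat).
Notation leb := (@lebesgue_measure R).
Notation lebn := (@lebesgue_tuple R n).
Implicit Types (K : 'M[R]_n) (x : n.-tuple R) (j : 'I_n) (f : n.-tuple R -> R).
Local Open Scope ereal_scope.

Lemma measurable_coord_powR j (a : R) :
  measurable_fun [set: n.-tuple R] (fun x => `|tnth x j| `^ a)%R.
Proof.
apply: (@measurableT_comp _ _ _ _ _ _ (fun y : R => y `^ a)%R).
  exact: measurable_powR.
apply: (@measurableT_comp _ _ _ _ _ _ (fun y : R => `|y|)%R).
  exact: normr_measurable.
exact: measurable_coord.
Qed.

Lemma gauss_int_ge0 K f : (forall y, 0 <= f y)%R -> 0 <= gauss_int K f.
Proof. by move=> f0; apply: integral_ge0 => x _; exact: weighted_ge0. Qed.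

(** [C] is chosen before [f], so it cancels when two integrands are compared; measurability in [y]
    is what monotonicity of the integral over [y] asks for. *)
Lemma gauss_int_mixture K j (nu : R) : (0 < nu)%R ->
  exists2 C : R, (0 < C)%R & forall f,
    measurable_fun [set: n.-tuple R] f -> (forall y, 0 <= f y)%R ->
    measurable_fun [set: R]
      (fun y => (expR (nu * y))%:E * gauss_int (K + expR y *: delta_mx j j) f) /\
    C%:E * gauss_int K (fun x => `|tnth x j| `^ (- 2 * nu) * f x)%R =
    \int[leb]_y ((expR (nu * y))%:E * gauss_int (K + expR y *: delta_mx j j) f).
Proof.
move=> nu0; have [C C0 mixE] := powR_gaussian_mixture nu0.
exists C => // f mf f0.
pose H (z : n.-tuple R * R) := (f z.1 * gauss_weight K z.1 *
  expR (nu * z.2 - expR z.2 * (2^-1 * tnth z.1 j ^+ 2)))%:E.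
have H0 z : 0 <= H z.
  by rewrite lee_fin !mulr_ge0 ?expR_ge0// ltW// gauss_weight_gt0.
have mj : measurable_fun [set: n.-tuple R * R] (fun z => tnth z.1 j).
  apply: (@measurableT_comp _ _ _ _ _ _ (fun x => tnth x j)) => //.
  exact: measurable_coord.
have mH : measurable_fun [set: n.-tuple R * R] H.
  apply/measurable_EFinP; apply: measurable_funM.
    apply: measurable_funM; apply: measurableT_comp => //.
    exact: measurable_gauss_weight.
  apply: measurableT_comp => //; apply: measurable_funB; first exact: measurable_funM.
  apply: measurable_funM; first exact: measurableT_comp.
  by apply: measurable_funM => //; exact: measurable_funX.
have GE y : (expR (nu * y))%:E * gauss_int (K + expR y *: delta_mx j j) f =
    \int[lebn]_x H (x, y).
  have mfK := measurable_weighted (K + expR y *: delta_mx j j) mf.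
  have fK0 := weighted_ge0 (K + expR y *: delta_mx j j) f0.
  have e0 : 0 <= (expR (nu * y))%:E by rewrite lee_fin expR_ge0.
  rewrite /gauss_int -ge0_integralZl//; apply: eq_integral => x _.
  rewrite /H/= -EFinM; congr EFin; rewrite gauss_weightD mulrC -!mulrA.
  do 2! congr (_ * _)%R; rewrite -expRD; congr expR; ring.
split.
  under eq_fun do rewrite GE.
  exact: (measurable_fun_fubini_tonelli_G (m1 := lebn) H mH H0).
under [RHS]eq_integral do rewrite GE.
rewrite -(fubini_tonelli (m1 := lebn) (m2 := leb) H mH H0).
have mwf : measurable_fun [set: n.-tuple R]
    (fun x => `|tnth x j| `^ (- 2 * nu) * f x)%R.
  by apply: measurable_funM => //; exact: measurable_coord_powR.
have wf0 x : (0 <= `|tnth x j| `^ (- 2 * nu) * f x)%R.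
  by rewrite mulr_ge0// powR_ge0.
have mwK := measurable_weighted K mwf; have wK0 := weighted_ge0 K wf0.
have CE0 : 0 <= C%:E by rewrite lee_fin ltW.
rewrite /gauss_int -ge0_integralZl//.
(* The pointwise mixture formula fails where [x_j = 0], a null set. *)
apply: ge0_ae_eq_integral => //.
- exact: measurable_funeM.
- exact: (measurable_fun_fubini_tonelli_F (m2 := leb) H mH H0).
- by move=> x _; rewrite mule_ge0.
- by move=> x _; exact: integral_ge0.
have mN : measurable [set x : n.-tuple R | tnth x j = 0%R].
  rewrite (_ : mkset _ = setT `&` (fun x : n.-tuple R => tnth x j) @^-1` [set 0%R]).
    exact: (measurable_coord j).
  by rewrite setTI.
exists [set x | tnth x j = 0%R]; split => //.
  exact: lebesgue_tuple_hyperplane.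
move=> x /=; apply: contra_notP => /eqP xj0 _.
have HE y : H (x, y) = (f x * gauss_weight K x)%:E *
  (expR (nu * y - expR y * (2^-1 * tnth x j ^+ 2)))%:E by [].
under eq_integral do rewrite HE.
have mm := measurable_mixture nu (2^-1 * tnth x j ^+ 2).
have fx0 := weighted_ge0 K f0 x.
rewrite ge0_integralZl// mixE// -!EFinM; congr EFin; ring.
Qed.

(** Indexed by a list, so that an induction can peel off one factor. *)
Definition powR_weight (nu : 'I_n -> R) (s : seq 'I_n) x : R :=
  (\prod_(j <- s) `|tnth x j| `^ (- 2 * nu j))%R.

Lemma powR_weight_ge0 nu s x : (0 <= powR_weight nu s x)%R.
Proof. by apply: prodr_ge0 => j _; exact: powR_ge0. Qed.

Lemma measurable_powR_weight nu s :
  measurable_fun [set: n.-tuple R] (powR_weight nu s).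
Proof. by apply: measurable_prod => j _; exact: measurable_coord_powR. Qed.

(** The values may be infinite: only the finite positive scalars [C], [e^(nu y)] and [r] are
    cancelled. *)
Lemma gauss_int_powR_weight_le nu s K f :
  (forall j, j \in s -> 0 <= nu j)%R -> posdefmx K ->
  measurable_fun [set: n.-tuple R] f -> (forall y, 0 <= f y)%R ->
  tuple_convex f ->
  gauss_int K (fun x => powR_weight nu s x * f x)%R * gauss_int K (cst 1%R) <=
  gauss_int K (powR_weight nu s) * gauss_int K f.
Proof.
move=> nu0 pK mf f0 cf; elim: s K nu0 pK => [|j s IH] K nu0 pK.
  rewrite (_ : powR_weight nu [::] = cst 1%R); last first.
    by apply/funext => x; rewrite /powR_weight big_nil.
  by rewrite muleC; under [X in _ * gauss_int _ X]eq_fun do rewrite mul1r.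
have {}IH K' : posdefmx K' ->
  gauss_int K' (fun x => powR_weight nu s x * f x)%R * gauss_int K' (cst 1%R) <=
  gauss_int K' (powR_weight nu s) * gauss_int K' f.
  by apply: IH => i si; apply: nu0; rewrite inE si orbT.
have wE : powR_weight nu (j :: s) =
    (fun x => `|tnth x j| `^ (- 2 * nu j) * powR_weight nu s x)%R.
  by apply/funext => x; rewrite /powR_weight big_cons.
have := nu0 j; rewrite inE eqxx => /(_ isT).
(* The mixture requires a positive exponent; for [nu j = 0] the factor is 1, even at 0. *)
rewrite le_eqVlt => /predU1P[nuj0|nuj0].
  rewrite (_ : powR_weight nu (j :: s) = powR_weight nu s); first exact: IH.
  by rewrite wE -nuj0; apply/funext => x; rewrite mulr0 powRr0 mul1r.
have [C C0 mixE] := gauss_int_mixture K j nuj0.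
have mw := measurable_powR_weight nu s; have w0 := powR_weight_ge0 nu s.
have mwf : measurable_fun [set: n.-tuple R] (fun x => powR_weight nu s x * f x)%R.
  exact: measurable_funM.
have wf0 x : (0 <= powR_weight nu s x * f x)%R by rewrite mulr_ge0.
have [m1 E1] := mixE _ mwf wf0; have [m2 E2] := mixE _ mw w0.
have g1 := gauss_int_ge0 (f := cst 1%R) K (fun=> ler01).
have gf := gauss_int_ge0 K f0.
rewrite -(@lee_pmul2l _ C%:E) ?lte_fin// !muleA.
have -> : gauss_int K (fun x => powR_weight nu (j :: s) x * f x)%R =
    gauss_int K (fun x => `|tnth x j| `^ (- 2 * nu j) * (powR_weight nu s x * f x))%R.
  by rewrite wE; under eq_fun do rewrite -mulrA.
rewrite [in leRHS]wE E1 E2.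
have G0 (h : n.-tuple R -> R) y : (forall x, 0 <= h x)%R ->
    0 <= (expR (nu j * y))%:E * gauss_int (K + expR y *: delta_mx j j) h.
  move=> h0; apply: mule_ge0; first by rewrite lee_fin expR_ge0.
  exact: gauss_int_ge0.
have G1 y := G0 (fun x => powR_weight nu s x * f x)%R y wf0.
have G2 y := G0 (powR_weight nu s) y w0.
set I1 := gauss_int K (cst 1%R) in g1 *; set If := gauss_int K f in gf *.
rewrite -(ge0_integralZr leb measurableT m1 (fun y _ => G1 y) g1).
rewrite -(ge0_integralZr leb measurableT m2 (fun y _ => G2 y) gf).
have n1 y : [set: R] y -> 0 <= (expR (nu j * y))%:E *
    gauss_int (K + expR y *: delta_mx j j) (fun x => powR_weight nu s x * f x)%R * I1.
  by move=> _; apply: mule_ge0; [exact: G1|exact: g1].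
apply: ge0_le_integral; [exact: measurableT|exact: n1| | |].
- by apply: emeasurable_funM => //; exact: measurable_cst.
- by apply: emeasurable_funM => //; exact: measurable_cst.
move=> y _; rewrite -!muleA; apply: lee_wpmul2l; first by rewrite lee_fin expR_ge0.
have [r r0 [rE rle]] := gauss_int_step j pK (expR_gt0 y).
have pK' : posdefmx (K + expR y *: delta_mx j j).
  by apply: posdefmxD => //; exact: expR_ge0.
(* Multiplying by [r] turns [I1] into the mass of the tilted weight, as the induction hypothesis
   requires. *)
rewrite -(@lee_pmul2l _ r%:E) ?lte_fin//.
rewrite muleCA -rE; apply: (le_trans (IH _ pK')).
rewrite muleCA; apply: lee_wpmul2l; first exact: gauss_int_ge0.
exact: rle.
Qed.

(** Coercivity bounds the Gaussian weight by a product of one-dimensional ones, and Tonelli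
    separates the coordinates. *)
Lemma gauss_int_powR_lty (J : {set 'I_n}) (nu : 'I_n -> R) K :
  (forall j, j \in J -> 0 <= nu j < 1 / 2)%R -> posdefmx K ->
  gauss_int K (fun x => \prod_(j in J) `|tnth x j| `^ (- 2 * nu j))%R < +oo.
Proof.
move=> nuJ pK; have [c c0 Kc] := posdefmx_coercive pK.
(* Outside [J] the exponent 0 gives the factor 1, so that all coordinates are treated alike. *)
pose mu j := if j \in J then nu j else 0%R.
have muJ j : (0 <= mu j < 1 / 2)%R.
  by rewrite /mu; case: ifPn => [/nuJ//|_]; apply/andP; split; lra.
pose h j (y : R) := (`|y| `^ (- 2 * mu j) * expR (- 2^-1 * (c * y ^+ 2)))%:E.
have mh j : measurable_fun [set: R] (h j).
  apply/measurable_EFinP; apply: measurable_funM.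
    apply: (@measurableT_comp _ _ _ _ _ _ (fun y : R => y `^ (- 2 * mu j))%R).
      exact: measurable_powR.
    exact: normr_measurable.
  apply: measurableT_comp => //; apply: measurable_funM => //.
  by apply: measurable_funM => //; exact: measurable_funX.
have h0 j y : 0 <= h j y by rewrite lee_fin mulr_ge0 ?powR_ge0 ?expR_ge0.
have mW : measurable_fun [set: n.-tuple R]
    (fun x => \prod_(j in J) `|tnth x j| `^ (- 2 * nu j))%R.
  rewrite (_ : (fun x => _) = powR_weight nu (enum J)).
    exact: measurable_powR_weight.
  by apply/funext => x; rewrite /powR_weight big_enum.
have W0 x : (0 <= \prod_(j in J) `|tnth x j| `^ (- 2 * nu j))%R.
  by apply: prodr_ge0 => j _; exact: powR_ge0.
have hE x : \prod_(j < n) h j (tnth x j) =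
    ((\prod_(j in J) `|tnth x j| `^ (- 2 * nu j)) *
     expR (- 2^-1 * (c * (\sum_j tnth x j ^+ 2))))%:E.
  rewrite /h prodEFin; congr EFin; rewrite big_split/=; congr (_ * _)%R.
    rewrite [RHS]big_mkcond/=; apply: eq_bigr => j _.
    by rewrite /mu; case: ifP => // _; rewrite mulr0 powRr0.
  by rewrite !mulr_sumr expR_sum.
apply: (@le_lt_trans _ _ (\int[lebn]_x \prod_(j < n) h j (tnth x j))).
  under [leRHS]eq_integral do rewrite hE.
  apply: ge0_le_integral => //.
  - by move=> x _; exact: (weighted_ge0 K W0).
  - exact: (measurable_weighted K mW).
  - apply/measurable_EFinP; apply: measurable_funM => //.
    apply: measurableT_comp => //; apply: measurable_funM => //.
    apply: measurable_funM => //; apply: measurable_sum => j.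
    by apply: measurable_funX; exact: measurable_coord.
  move=> x _; rewrite lee_fin ler_wpM2l// ler_expR ler_wnM2l//.
  have := Kc (\row_i tnth x i); under eq_bigr do rewrite mxE.
  exact.
rewrite integral_lebesgue_tuple_prod//.
(* Nonnegativity is carried along, since a product of finite values is bounded through it. *)
have /andP[] : (0 <= \prod_(j < n) \int[leb]_y h j y) &&
    (\prod_(j < n) \int[leb]_y h j y < +oo); last by [].
elim/big_ind : _ => [|a b /andP[a0 aoo] /andP[b0 boo]|j _].
- by rewrite lee_fin ler01 ltry.
- rewrite mule_ge0//= lte_mul_pinfty// ge0_fin_numE//.
- by rewrite integral_ge0//= integral_powR_gaussian.
Qed.

End powR_weight.

(** * Reflection through the origin *)

Lemma qformN (R : realType) n (K : 'M[R]_n) (v : 'rV[R]_n) : qform K (- v) = qform K v.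
Proof. by rewrite /qform linearN !mulNmx mulmxN opprK. Qed.

Definition tuple_opp (R : realType) n (x : n.-tuple R) : n.-tuple R :=
  [tuple - tnth x i | i < n].

Lemma measurable_tuple_opp (R : realType) n :
  measurable_fun [set: n.-tuple R] (@tuple_opp R n).
Proof.
apply/measurable_fun_tnthP => i.
rewrite (_ : _ \o _ = (fun x : n.-tuple R => - tnth x i)).
  by apply: measurableT_comp => //; exact: measurable_coord.
by apply/funext => x /=; rewrite tnth_mktuple.
Qed.

Lemma gauss_int_opp (R : realType) n (K : 'M[R]_n) (h : n.-tuple R -> R) :
  measurable_fun [set: n.-tuple R] h -> (forall x, 0 <= h x) ->
  gauss_int K (h \o @tuple_opp R n) = gauss_int K h.
Proof.
move=> mh h0.
have mF := measurable_weighted K mh; have F0 := weighted_ge0 K h0.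
rewrite /gauss_int -[RHS](lebesgue_tuple_opp mF F0).
apply: eq_integral => x _ /=; congr (_ * _)%:E; rewrite /gauss_weight.
rewrite (_ : \row_i tnth [tuple - tnth x i0 | i0 < n] i = - \row_i tnth x i).
  by rewrite qformN.
by apply/rowP => i; rewrite !mxE tnth_mktuple.
Qed.

(** Serves both sides of the symmetrization, with [h] the weight and with [h] the constant 1; [fine]
    brings the result into the reals, where terms can be cancelled. *)
Lemma integral_lincomb d (T : measurableType d) (R : realType)
    (P : probability T R) (f g h : T -> R) (k : R) :
  P.-integrable setT (EFin \o f) -> P.-integrable setT (EFin \o g) ->
  P.-integrable setT (EFin \o h) ->
  (\int[P]_w (2^-1 * (f w + g w) - k * h w)%:E =
   (2^-1 * (fine (\int[P]_w (f w)%:E) + fine (\int[P]_w (g w)%:E))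
    - k * fine (\int[P]_w (h w)%:E))%:E)%E.
Proof.
move=> If Ig Ih.
have Ifg := integrableD measurableT If Ig.
have I1 := integrableZl measurableT 2^-1 Ifg.
have I2 := integrableZl measurableT k Ih.
rewrite EFinB !EFinM EFinD !fineK; last 3 first.
- exact: integrable_fin_num Ih.
- exact: integrable_fin_num Ig.
- exact: integrable_fin_num If.
rewrite -(integralD measurableT If Ig) -(integralZl measurableT Ifg).
rewrite -(integralZl measurableT Ih) -(integralB measurableT I1 I2).
exact: eq_integral.
Qed.

(** * Expectations under the Gaussian law *)

Section gaussian_law.
Local Open Scope ereal_scope.
Context (R : realType) (dT : measure_display) (T : measurableType dT)
  (P : probability T R) (n : nat) (Sigma : 'M[R]_n) (X : {RV P >-> n.-tuple R}).
Hypothesis lawX : forall A : set (n.-tuple R), measurable A ->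
  distribution P X A = multinormal_prob Sigma A.

Let mX : measurable_fun [set: T] X.
Proof. exact: measurable_funPT. Qed.

(** The normalizing constant stays behind an existential: taking [h = 1], of expectation 1,
    determines it. *)
Lemma integral_gaussian_law : exists2 c : R, (0 <= c)%R &
  forall h : n.-tuple R -> R, measurable_fun [set: n.-tuple R] h ->
    (forall x, 0 <= h x)%R ->
    \int[P]_w (h (X w))%:E = c%:E * gauss_int (invmx Sigma) h.
Proof.
pose c : R := (Num.sqrt ((2 * pi) ^+ n * \det Sigma))^-1%R.
have c0 : (0 <= c)%R by rewrite invr_ge0.
exists c => // h mh h0; pose mu := pushforward_measure P mX.
have pdfE x : multinormal_pdf Sigma x = (c * gauss_weight (invmx Sigma) x)%R by [].
have mpdf : measurable_fun [set: n.-tuple R] (multinormal_pdf Sigma).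
  rewrite (_ : multinormal_pdf _ = fun x => c * gauss_weight (invmx Sigma) x)%R//.
  by apply: measurable_funM => //; exact: measurable_gauss_weight.
have pdf0 x : (0 <= multinormal_pdf Sigma x)%R.
  by rewrite pdfE mulr_ge0// ltW// gauss_weight_gt0.
have mhE : measurable_fun [set: n.-tuple R] (fun x => (h x)%:E).
  exact/measurable_EFinP.
have hE0 x : 0 <= (h x)%:E by rewrite lee_fin.
transitivity (\int[mu]_x (h x)%:E).
  by rewrite [RHS](ge0_integral_pushforward mX).
rewrite (@ge0_integral_density _ _ _ (@lebesgue_tuple R n) mu _ mpdf pdf0 lawX
  _ mhE hE0).
have mw := measurable_weighted (invmx Sigma) mh.
have w0 := weighted_ge0 (invmx Sigma) h0.
have cE0 : 0 <= c%:E by rewrite lee_fin.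
rewrite /gauss_int -ge0_integralZl//.
by apply: eq_integral => x _; rewrite pdfE -!EFinM; congr EFin; ring.
Qed.

Lemma ge0_integral_law_opp (h : n.-tuple R -> R) :
  measurable_fun [set: n.-tuple R] h -> (forall x, 0 <= h x)%R ->
  \int[P]_w (h (tuple_opp (X w)))%:E = \int[P]_w (h (X w))%:E.
Proof.
move=> mh h0; have [c c0 cE] := integral_gaussian_law.
have mh' : measurable_fun [set: n.-tuple R] (h \o @tuple_opp R n).
  by apply: measurableT_comp => //; exact: measurable_tuple_opp.
have h'0 x : (0 <= (h \o @tuple_opp R n) x)%R by exact: h0.
by rewrite (cE _ mh h0) -(gauss_int_opp _ mh h0) -(cE _ mh' h'0).
Qed.

(** Positive and negative parts are reflected separately, each by the nonnegative case. *)
Lemma integral_law_opp (h : n.-tuple R -> R) :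
  measurable_fun [set: n.-tuple R] h ->
  \int[P]_w (h (tuple_opp (X w)))%:E = \int[P]_w (h (X w))%:E.
Proof.
move=> mh; rewrite integralE [RHS]integralE.
have posE (Y : T -> R) w : (EFin \o Y)^\+ w = (Num.max (Y w) 0)%:E.
  by rewrite funeposE EFin_max.
have negE (Y : T -> R) w : (EFin \o Y)^\- w = (Num.max (- Y w) 0)%:E.
  by rewrite funenegE EFin_max.
congr (_ - _).
- have m0 : measurable_fun [set: n.-tuple R] (fun x => Num.max (h x) 0)%R.
    exact: measurable_maxr.
  have p0 x : (0 <= Num.max (h x) 0)%R by rewrite le_max lexx orbT.
  transitivity (\int[P]_w (Num.max (h (tuple_opp (X w))) 0)%:E).
    by apply: eq_integral => w _; exact: (posE (fun w => h (tuple_opp (X w))) w).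
  rewrite (ge0_integral_law_opp m0 p0).
  by apply: eq_integral => w _; exact/esym/(posE (fun w => h (X w)) w).
- have m0 : measurable_fun [set: n.-tuple R] (fun x => Num.max (- h x) 0)%R.
    by apply: measurable_maxr => //; exact: measurableT_comp.
  have p0 x : (0 <= Num.max (- h x) 0)%R by rewrite le_max lexx orbT.
  transitivity (\int[P]_w (Num.max (- h (tuple_opp (X w))) 0)%:E).
    by apply: eq_integral => w _; exact: (negE (fun w => h (tuple_opp (X w))) w).
  rewrite (ge0_integral_law_opp m0 p0).
  by apply: eq_integral => w _; exact/esym/(negE (fun w => h (X w)) w).
Qed.

Lemma integrable_law_opp (h : n.-tuple R -> R) :
  measurable_fun [set: n.-tuple R] h ->
  P.-integrable setT (fun w => (h (X w))%:E) ->
  P.-integrable setT (fun w => (h (tuple_opp (X w)))%:E).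
Proof.
move=> mh /integrableP[_ hoo]; apply/integrableP; split.
  apply/measurable_EFinP; apply: measurableT_comp => //.
  by apply: measurableT_comp => //; exact: measurable_tuple_opp.
have mn : measurable_fun [set: n.-tuple R] (fun x => `|h x|)%R.
  exact: measurableT_comp.
by rewrite (ge0_integral_law_opp mn).
Qed.

End gaussian_law.

(** * From nonnegative even convex functions to arbitrary convex ones *)

Lemma convex_functionE (R : realType) m (psi : 'rV[R]_m -> R) (t : R)
    (u v : 'rV[R]_m) : convex_function setT psi -> 0 <= t <= 1 ->
  psi (t *: u + (1 - t) *: v) <= t * psi u + (1 - t) * psi v.
Proof.
move=> cpsi /andP[t0 t1].
have := cpsi (Itv01 t0 t1) u v (mem_set I) (mem_set I).
by rewrite convRE.
Qed.

Theorem theorem2 (R : realType) (dT : measure_display)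
    (T : measurableType dT) (P : probability T R)
    (d : nat) (Sigma : 'M[R]_d) (X : {RV P >-> d.-tuple R})
    (J : {set 'I_d}) (nu : 'I_d -> R) (psi : 'rV[R]_#|~: J| -> R) :
  posdefmx Sigma ->
  (forall A : set (d.-tuple R), measurable A ->
    distribution P X A = multinormal_prob Sigma A) ->
  J != finset.set0 -> J \proper finset.setT ->
  (forall j, j \in J -> 0 <= nu j < 1 / 2) ->
  convex_function setT psi ->
  let W (w : T) := \prod_(j in J) (`|tnth (X w) j| `^ (- 2 * nu j)) in
  let psiX (w : T) := psi (\row_i tnth (X w) (enum_val i)) in
  P.-integrable setT (EFin \o (fun w => W w * psiX w)) ->
  P.-integrable setT (EFin \o psiX) ->
  ('E_P[fun w => (W w * psiX w)%R] <= 'E_P[W] * 'E_P[psiX])%E.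
Proof.
move=> pS lawX _ _ nuJ cpsi W psiX IWpsi Ipsi.
have pK := posdefmx_inv pS; set K := invmx Sigma in pK.
have [c c0 cE] := integral_gaussian_law lawX; rewrite -/K in cE.
pose sel (x : d.-tuple R) : 'rV[R]_#|~: J| := \row_i tnth x (enum_val i).
pose f x := psi (sel x).
have cf : tuple_convex f.
  move=> t x y t01; have := convex_functionE (sel x) (sel y) cpsi t01.
  rewrite (_ : t *: sel x + _ =
    sel [tuple t * tnth x i + (1 - t) * tnth y i | i < d])//.
  by apply/rowP => i; rewrite !mxE tnth_mktuple.
have mf := measurable_tuple_convex cf.
have sel_opp x : sel (tuple_opp x) = - sel x.
  by apply/rowP => i; rewrite !mxE tnth_mktuple.
pose phi x := 2^-1 * (f x + f (tuple_opp x)) - psi 0.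
(* Midpoint convexity between [sel x] and [- sel x], whose midpoint is 0. *)
have phi0 x : 0 <= phi x.
  have h01 : 0 <= (2^-1 : R) <= 1 by apply/andP; split; lra.
  have := convex_functionE (sel x) (- sel x) cpsi h01.
  rewrite (_ : _ + _ = 0); last first.
    by rewrite scalerN (_ : 1 - 2^-1 = 2^-1 :> R) ?subrr//; lra.
  by rewrite /phi /f sel_opp; lra.
have cphi : tuple_convex phi.
  move=> t x y t01; have := cf t x y t01.
  have := cf t (tuple_opp x) (tuple_opp y) t01.
  rewrite (_ : [tuple t * tnth (tuple_opp x) i + _ | i < d] =
    tuple_opp [tuple t * tnth x i + (1 - t) * tnth y i | i < d]); last first.
    by apply: eq_from_tnth => i; rewrite !tnth_mktuple; ring.
  rewrite /phi; set a := f _; set b := f _; nra.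
have mphi := measurable_tuple_convex cphi.
pose V := powR_weight nu (enum J).
have mV : measurable_fun [set: d.-tuple R] V by exact: measurable_powR_weight.
have V0 x : 0 <= V x by exact: powR_weight_ge0.
have WE w : W w = V (X w) by rewrite /W /V /powR_weight big_enum.
have V_opp x : V (tuple_opp x) = V x.
  by apply: eq_bigr => j _; rewrite tnth_mktuple normrN.
have mX : measurable_fun [set: T] X by exact: measurable_funPT.
have intP1 : (\int[P]_w (1 : R)%:E = 1)%E.
  by rewrite integral_cst//= probability_setT mule1.
have c1 : (1 = c%:E * gauss_int K (cst 1%R))%E.
  by rewrite -cE//; exact/esym/intP1.
(* Finiteness of [E[W]] is what allows [psi 0 * E[W]] to be subtracted. *)
have IV : P.-integrable setT (EFin \o (fun w => V (X w))).
  apply/integrableP; split.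
    by apply/measurable_EFinP; exact: measurableT_comp.
  under eq_integral do rewrite /= ger0_norm//.
  rewrite cE// lte_mul_pinfty ?lee_fin//.
  rewrite /V (_ : powR_weight _ _ =
    fun x => \prod_(j in J) (`|tnth x j| `^ (- 2 * nu j))).
    exact: gauss_int_powR_lty.
  by apply/funext => x; rewrite /powR_weight big_enum.
have IVf : P.-integrable setT (EFin \o (fun w => V (X w) * f (X w))).
  by move: IWpsi; under eq_fun do rewrite WE.
have mVf : measurable_fun [set: d.-tuple R] (fun x => V x * f x).
  exact: measurable_funM.
have I1 : P.-integrable setT (EFin \o cst (1 : R)).
  exact: finite_measure_integrable_cst.
have IVf' := integrable_law_opp lawX mVf IVf.
have If' := integrable_law_opp lawX mf Ipsi.
have EVphi := integral_lincomb (psi 0) IVf IVf' IV.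
have Ephi := integral_lincomb (psi 0) Ipsi If' I1.
rewrite (integral_law_opp lawX mVf) in EVphi.
rewrite (integral_law_opp lawX mf) in Ephi.
have mVphi : measurable_fun [set: d.-tuple R] (fun x => V x * phi x).
  exact: measurable_funM.
have Vphi0 x : 0 <= V x * phi x by rewrite mulr_ge0.
have main : (\int[P]_w (V (X w) * phi (X w))%:E <=
    (\int[P]_w (V (X w))%:E) * \int[P]_w (phi (X w))%:E)%E.
  have nu0 j : j \in enum J -> 0 <= nu j.
    by rewrite mem_enum => /nuJ /andP[].
  have cE0 : (0 <= c%:E)%E by rewrite lee_fin.
  have := gauss_int_powR_weight_le nu0 pK mphi phi0 cphi.
  rewrite (cE _ mVphi Vphi0) (cE _ mV V0) (cE _ mphi phi0) -/V.
  set A := gauss_int K (fun x => V x * phi x).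
  set O := gauss_int K (cst 1) in c1 *.
  set B := gauss_int K V; set D := gauss_int K phi => AOBD.
  (* The factor [c * O = 1] is inserted so that both sides carry [c] twice. *)
  have -> : (c%:E * A = c%:E * (c%:E * (A * O)))%E.
    by rewrite (muleC A) (muleA c%:E O) -c1 mul1e.
  have -> : (c%:E * B * (c%:E * D) = c%:E * (c%:E * (B * D)))%E.
    by rewrite -muleA (muleCA B).
  by do 2! apply: lee_wpmul2l => //.
have fVf := integrable_fin_num measurableT IVf.
have fV := integrable_fin_num measurableT IV.
have ff := integrable_fin_num measurableT Ipsi.
rewrite unlock.
have -> : (\int[P]_w (W w * psiX w)%:E = \int[P]_w (V (X w) * f (X w))%:E)%E.
  by apply: eq_integral => w _; rewrite WE.
have -> : (\int[P]_w (W w)%:E = \int[P]_w (V (X w))%:E)%E.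
  by apply: eq_integral => w _; rewrite WE.
have E1 : (\int[P]_w (V (X w) * phi (X w))%:E = \int[P]_w
    (2^-1 * (V (X w) * f (X w) + V (tuple_opp (X w)) * f (tuple_opp (X w))) -
     psi 0 * V (X w))%:E)%E.
  by apply: eq_integral => w _; congr EFin; rewrite V_opp /phi; ring.
have E2 : (\int[P]_w (phi (X w))%:E = \int[P]_w
    (2^-1 * (f (X w) + f (tuple_opp (X w))) - psi 0 * cst 1 w)%:E)%E.
  by apply: eq_integral => w _; congr EFin; rewrite /phi /=; ring.
have E3 : (\int[P]_w (cst (1 : R) w)%:E = 1)%E by exact: intP1.
(* By evenness the two halves coincide on each side, and the term [psi 0 * E[W]] cancels. *)
move: main; rewrite E1 EVphi E2 Ephi E3 -(fineK fVf) -(fineK fV) -(fineK ff).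
rewrite /= -!EFinM !lee_fin => h; nra.
Qed.
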